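(* Let $p$ be a prime, and let $E_p:=\mathcal M_p^\infty/p^{\mathbf Z}\cong\mathbf C^\times/p^{\mathbf Z}$ be the complex Tate curve. Then $E_p$ admits a canonical global decomposition $$E_p\;\cong\; C_p\times\tilde{\mathcal X}_\infty .$$ The canonical nowhere-vanishing holomorphic $1$-form on $E_p$ is given by $$\omega=\frac{d\lambda}{\lambda}+i\,d\theta,$$ which uniquely intertwines the $1$-form $d\lambda/\lambda$ of the periodic orbit $C_p$ of length $\log p$ with the $1$-form $d\theta$ of the $p$-independent geometric factor $\tilde{\mathcal X}_\infty$ of length $2\pi$.
   Context: The $\mathbf F_1$-arithmetic curve is $\operatorname{Spec}\mathbf Z$ with a structure sheaf of $\mathbf F_1$-algebras whose stalk at a prime $p$ is the spherical monoid algebra $\mathbf F_1[T^{H_p^+}]$, where $H_p^+=\{a\in\mathbf Z[1/p]: a\ge 0\}$. Its $\mathbf C$-points at $p$ that are local for the archimedean place are the monoid homomorphisms $\rho:(H_p^+,+)\to(\mathbf C,\cdot)$, with $\rho(0)=1$, that are continuous for the topology on $H_p^+$ induced from $\mathbf R$ and the Euclidean topology on $\mathbf C$. They are exactly the maps $\rho_z(t)=\exp(zt)$, $z\in\mathbf C$. $\mathcal M_p^\infty$ denotes the space of non-trivial ones ($z\ne 0$), identified with $\mathbf C^\times$ via $z$, with the corresponding complex structure. The archimedean Weil group $W_\infty=\mathbf C^\times$ acts on $\mathcal M_p^\infty$ by $w\cdot\rho_z=\rho_{wz}$, making it a principal homogeneous space. The subgroup $p^{\mathbf Z}\subset W_\infty$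 is the group of discrete symmetries generated by Frobenius, acting by $z\mapsto pz$. The quotient $E_p$ is an elliptic curve over $\mathbf C$. $C_p=\mathbf R_+^\times/p^{\mathbf Z}$ is the periodic orbit associated with $p$ in adelic geometry, where $\mathbf R_+^\times$ is the multiplicative group of positive reals. Let $\sigma$ be complex conjugation on $W_\infty$, with fixed subgroup $W_\infty^\sigma=\mathbf R^\times$, and let $\mathcal X_\infty:=\mathcal M_p^\infty/W_\infty^\sigma\cong\mathbb P^1(\mathbf R)$. Then $\tilde{\mathcal X}_\infty$ is the canonical unramified double cover of $\mathcal X_\infty$, with deck transformation given by $-1\in W_\infty$; it is $\mathcal M_p^\infty/\mathbf R_+^\times$. The symbols $\lambda$ and $\theta$ are polar coordinates: a point of $E_p$ is represented by $z=\lambda e^{i\theta}\in\mathbf C^\times$ with $\lambda\in\mathbf R_+^\times$. The canonical holomorphic $1$-form is the logarithmic differential $dz/z$. *)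

(* Defs.v *)
From HB Require Import structures.
From mathcomp Require Import all_boot all_order all_algebra.
From mathcomp Require Import all_classical all_reals all_analysis.
From mathcomp Require Import complex.

Set Implicit Arguments.
Unset Strict Implicit.
Unset Printing Implicit Defensive.

Import Order.TTheory GRing.Theory Num.Theory.
Import numFieldNormedType.Exports.

Local Open Scope classical_set_scope.
Local Open Scope ring_scope.
Local Open Scope complex_scope.
Local Open Scope quotient_scope.

(** * Manifolds given by a local parametrization *)

Section smoothness.
Context {R : realType} {V W : normedModType R}.

(* f is of class C^n on the open set U. *)
Fixpoint class_C (n : nat) (U : set V) (f : V -> W) : Prop :=
  match n with
  | 0 => forall u, U u -> {for u, continuous f}
  | m.+1 => (forall u, U u -> differentiable f u) /\
            (forall v, class_C m U (fun u => 'd f u v))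
  end.

Definition smooth_on (U : set V) (f : V -> W) := forall n, class_C n U f.

Definition smooth_near (u : V) (f : V -> W) :=
  exists U, [/\ open U, U u & smooth_on U f].

End smoothness.

(* The local coordinates of X are the local inverses of cmap : V -> X on cdom;
   the values of cmap outside cdom are irrelevant. *)
Record coords (R : realType) (V : normedModType R) (X : Type) := Coords {
  cdom : set V;
  cmap :> V -> X
}.

Section manifolds.
Context {R : realType}.

Definition etale (V : normedModType R) (X : topologicalType)
    (c : coords V X) : Prop :=
  [/\ open (cdom c),
      c @` cdom c = setT,
      (forall u, cdom c u -> {for u, continuous (c : V -> X)}),
      (forall U, open U -> U `<=` cdom c -> open (c @` U)) &
      (forall u, cdom c u -> exists2 U, nbhs u U & set_inj U c)].

(* [phi] is a change of coordinates from near [u] to near [phi u]: both charts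
   are local inverses of [c]. *)
Definition transition (V : normedModType R) (X : Type) (c : coords V X)
    (u : V) (phi : V -> V) : Prop :=
  [/\ cdom c u, cdom c (phi u),
      \forall w \near u, {for w, continuous phi} &
      \forall w \near u, c (phi w) = c w].

Definition smooth_manifold (V : normedModType R) (X : topologicalType)
    (c : coords V X) : Prop :=
  etale c /\ (forall u phi, transition c u phi -> smooth_near u phi).

Definition prod_coords (V W : normedModType R) (X Y : Type)
    (c : coords V X) (d : coords W Y) : coords (V * W)%type (X * Y)%type :=
  Coords [set u | cdom c u.1 /\ cdom d u.2] (fun u => (c u.1, d u.2)).

(* [phi] expresses [f] in local coordinates near [u]. *)
Definition local_expr (V W : normedModType R) (X Y : Type)
    (c : coords V X) (d : coords W Y) (f : X -> Y) (u : V) (phi : V -> W) :=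
  [/\ smooth_near u phi, cdom d (phi u) &
      \forall w \near u, d (phi w) = f (c w)].

Definition smooth_map (V W : normedModType R) (X Y : Type)
    (c : coords V X) (d : coords W Y) (f : X -> Y) :=
  forall u, cdom c u -> exists phi, local_expr c d f u phi.

Definition diffeomorphism (V W : normedModType R) (X Y : topologicalType)
    (c : coords V X) (d : coords W Y) (f : X -> Y) :=
  [/\ continuous f, smooth_map c d f &
      exists g : Y -> X,
        [/\ cancel f g, cancel g f, continuous g & smooth_map d c g]].

(* A covector field with values in T is given by its expressions in the local
   coordinates: [alpha u v] is its value at the point [c u], on the tangent
   vector with components [v] in the coordinate defined near [u]. *)
Definition is_pullback (V W : normedModType R) (X Y T : Type)
    (c : coords V X) (d : coords W Y) (f : X -> Y)
    (alpha : W -> W -> T) (eta : V -> V -> T) : Prop :=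
  smooth_map c d f /\
  forall u, cdom c u -> forall phi, local_expr c d f u phi ->
    forall v, eta u v = alpha (phi u) ('d phi u v).

(* The expressions in the various coordinates define one and the same object
   on X: they agree under changes of coordinates. *)
Definition covector_field (V : normedModType R) (X T : Type) (c : coords V X)
    (alpha : V -> V -> T) : Prop :=
  is_pullback c c id alpha alpha.

Definition one_form (V : normedModType R) (X : Type) (c : coords V X)
    (alpha : V -> V -> R) : Prop :=
  [/\ covector_field c alpha,
      (forall u, cdom c u -> linear (alpha u : V -> R)) &
      (forall v, smooth_on (cdom c) (fun u => alpha u v : R))].

Definition simple_loop (X : Type) (c : coords R X) (a b : R) : Prop :=
  [/\ a < b, `[a, b] `<=` cdom c, set_bij `[a, b[ setT c & c b = c a].

(* The integral of alpha over the closed curve X, run through once. *)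
Definition total_length (X : Type) (c : coords R X) (alpha : R -> R -> R)
    (L : R) : Prop :=
  (exists a b, simple_loop c a b) /\
  forall a b, simple_loop c a b ->
    (\int[lebesgue_measure]_(t in `[a, b]) alpha t 1)%R = L.

(** ** Riemann surfaces: the coordinate (x, y) stands for z = x + i y *)

Definition cplx (u : R * R) : R[i] := u.1 +i* u.2.
Definition cart (z : R[i]) : R * R := (complex.Re z, complex.Im z).

Definition holomorphic_on (U : set R[i]) (h : R[i] -> R[i]) : Prop :=
  forall z, U z -> @derivable R[i] (R[i])^o (R[i])^o h z 1.

Definition riemann_surface (X : topologicalType)
    (c : coords (R * R)%type X) : Prop :=
  etale c /\
  forall u phi, transition c u phi ->
    \forall w \near u, holomorphic_on [set cplx w] (cplx \o phi \o cart).

(* In the local coordinate z, a holomorphic 1-form is h(z) dz. *)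
Definition holomorphic_form (X : Type) (c : coords (R * R)%type X)
    (eta : R * R -> R * R -> R[i]) : Prop :=
  covector_field c eta /\
  exists2 h : R[i] -> R[i], holomorphic_on (cplx @` cdom c) h &
    forall u, cdom c u -> forall v, eta u v = h (cplx u) * cplx v.

Definition nowhere_vanishing (V : normedModType R) (X : Type) (T : zmodType)
    (c : coords V X) (alpha : V -> V -> T) : Prop :=
  forall u, cdom c u -> exists v, alpha u v != 0.

End manifolds.

(** * The spaces attached to p *)

Section orbits.
Context {F : fieldType} (T : choiceType) (f : T -> F) (G : set F).
Context (G1 : G 1) (GM : forall x y, G x -> G y -> G (x * y))
  (GV : forall x, G x -> G x^-1) (G0 : ~ G 0).

Definition orbit_rel (x y : T) : bool := `[< exists2 g, G g & f y = g * f x >].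

Lemma orbit_equiv : equiv_class_of orbit_rel.
Proof using G1 GM GV G0.
split.
- by move=> x; apply/asboolP; exists 1; rewrite ?mul1r.
- suff sym x y : orbit_rel x y -> orbit_rel y x.
    by move=> x y; apply/idP/idP; apply: sym.
  move=> /asboolP[g Gg e]; apply/asboolP; exists g^-1; first exact: GV.
  by rewrite e mulKf//; apply/eqP => g0; apply: G0; rewrite -g0.
- move=> y x z /asboolP[g Gg e] /asboolP[h Gh e']; apply/asboolP.
  by exists (h * g); [exact: GM|rewrite e' e mulrA].
Qed.

End orbits.

Section groups.
Context {F : numFieldType} (p : nat) (hp : prime p).

Definition pZ : set F := range (fun n : int => p%:R ^ n : F).

Lemma pnz : p%:R != 0 :> F.
Proof using hp. by rewrite pnatr_eq0 -lt0n prime_gt0. Qed.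

Lemma pZ1 : pZ 1. Proof. by exists 0; rewrite ?expr0z. Qed.

Lemma pZM x y : pZ x -> pZ y -> pZ (x * y).
Proof using hp.
by move=> [m _ <-] [n _ <-]; exists (m + n) => //; rewrite expfzDr ?pnz.
Qed.

Lemma pZV x : pZ x -> pZ x^-1.
Proof. by move=> [m _ <-]; exists (- m); rewrite ?exprN ?invr_expz. Qed.

Lemma pZ0 : ~ pZ 0.
Proof using hp. by move=> [m _] /eqP; rewrite expfz_eq0 (negPf pnz) andbF. Qed.

Definition posreals : set F := [set x | 0 < x].

Lemma posreals1 : posreals 1. Proof. exact: ltr01. Qed.

Lemma posrealsM x y : posreals x -> posreals y -> posreals (x * y).
Proof. exact: mulr_gt0. Qed.

Lemma posrealsV x : posreals x -> posreals x^-1.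
Proof. by rewrite /posreals/= invr_gt0. Qed.

Lemma posreals0 : ~ posreals 0. Proof. by rewrite /posreals/= ltxx. Qed.

End groups.

Section spaces.
Context (R : realType) (p : nat).

Definition Hplus : set R :=
  [set a | 0 <= a /\ exists (k : int) (n : nat), a = k%:~R / p%:R ^+ n].

Definition cexp (z : R[i]) : R[i] :=
  expR (complex.Re z) * cos (complex.Im z)
    +i* (expR (complex.Re z) * sin (complex.Im z)).

Definition character : set (Hplus -> (R[i])^o) :=
  [set rho | [/\ (forall t : Hplus, \val t = 0 -> rho t = 1),
     (forall s t r : Hplus, \val r = \val s + \val t -> rho r = rho s * rho t),
     continuous (rho : (Hplus : topologicalType) -> (R[i])^o) &
     exists t, rho t != 1]].

Definition rho_fun (z : R[i]) : Hplus -> (R[i])^o :=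
  fun t => cexp (z * (\val t)%:C).

(* The z with rho = rho_z. *)
Definition zcoord (rho : character) : (R[i])^o :=
  xget 0 [set z | \val rho = rho_fun z].

(* The topology is the one carried over from C^x by z. *)
Definition Minf := initial_topology zcoord.

Lemma real_complex_continuous : continuous (fun x : R => x%:C : (R[i])^o).
Proof.
move=> x; apply/cvgrPdist_lt => e e0.
have /complex_realP[r er] : e \is Num.real by rewrite gtr0_real.
rewrite er ltcR in e0; near=> y; rewrite er -rmorphB normc_def/= expr0n addr0.
rewrite sqrtr_sqr ltcR; near: y; exact: cvgr_dist_lt.
Unshelve. all: by end_near. Qed.

Lemma character_rho1 : character (rho_fun 1).
Proof.
have rho1E t : rho_fun 1 t = (expR (\val t))%:C.
  by rewrite /rho_fun /cexp mul1r/= cos0 sin0 mulr1 mulr0.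
split.
- by move=> t t0; rewrite rho1E t0 expR0.
- by move=> s t r e; rewrite !rho1E e expRD rmorphM.
- rewrite (_ : rho_fun 1 = real_complex R \o (expR \o (\val : Hplus -> R))).
    move=> t; apply: continuous_comp; last exact: real_complex_continuous.
    apply: continuous_comp; last exact: continuous_expR.
    exact: initial_continuous.
  by apply/funext => t; rewrite rho1E.
- have H1 : Hplus 1 by split=> //; exists 1, 0%N; rewrite expr0 divr1.
  exists (exist _ 1 (mem_set H1)); rewrite rho1E/= -(rmorph1 (real_complex R)).
  by rewrite (inj_eq (@complexI _)) gt_eqF ?expR_gt1.
Qed.

(* rho z is rho_z for z != 0; its value at z = 0 is irrelevant. *)
Definition rho (z : R[i]) : Minf :=
  insigd (mem_set character_rho1) (rho_fun z).

Section quotients.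
Context (hp : prime p).

(* W_oo = C^x acts by w . rho_z = rho_{wz}, i.e. zcoord (w . r) = w * zcoord r.
   The quotient by R_+^x below uses the order of R[i], in which 0 < w means
   that w is real and positive. *)
Definition pZ_orbit : rel Minf :=
  orbit_rel (zcoord : Minf -> R[i]) (@pZ R[i] p).

Definition pZ_orbit_equiv : equiv_class_of pZ_orbit :=
  orbit_equiv _ (pZ1 p) (pZM hp) (@pZV _ p) (pZ0 hp).

Canonical pZ_equiv := EquivRelPack pZ_orbit_equiv.

Definition Ecurve := quotient_topology {eq_quot pZ_equiv}.

Definition Rplus_orbit : rel Minf :=
  orbit_rel (zcoord : Minf -> R[i]) (@posreals R[i]).

Definition Rplus_orbit_equiv : equiv_class_of Rplus_orbit :=
  orbit_equiv _ (@posreals1 _) (@posrealsM _) (@posrealsV _) (@posreals0 _).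

Canonical Rplus_equiv := EquivRelPack Rplus_orbit_equiv.

Definition Xtilde := quotient_topology {eq_quot Rplus_equiv}.

Definition Rpos : topologicalType := @posreals R.

Definition Cp_orbit : rel Rpos := orbit_rel (\val : Rpos -> R) (@pZ R p).

Definition Cp_orbit_equiv : equiv_class_of Cp_orbit :=
  orbit_equiv _ (pZ1 p) (pZM hp) (@pZV _ p) (pZ0 hp).

Canonical Cp_equiv := EquivRelPack Cp_orbit_equiv.

Definition Cp := quotient_topology {eq_quot Cp_equiv}.

Definition to_Rpos (x : R) : Rpos :=
  insigd (mem_set (@posreals1 R)) x.

Definition to_E (r : Minf) : Ecurve := \pi_{eq_quot pZ_equiv} r.
Definition to_X (r : Minf) : Xtilde := \pi_{eq_quot Rplus_equiv} r.
Definition to_C (x : R) : Cp := \pi_{eq_quot Cp_equiv} (to_Rpos x).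

Definition cmod (z : R[i]) : R := Normc.normc z.

Definition coordsE : coords (R * R)%type Ecurve :=
  Coords [set u | u != 0] (fun u => to_E (rho (cplx u))).

Definition coordsC : coords R Cp := Coords (@posreals R) to_C.

Definition coordsX : coords R Xtilde :=
  Coords setT (fun theta => to_X (rho (cexp (0 +i* theta)))).

(* z |-> (|z|, z mod R_+^x); well defined on p^Z-orbits. *)
Definition decomposition (e : Ecurve) : Cp * Xtilde :=
  let r := repr (e : {eq_quot pZ_equiv}) in (to_C (cmod (zcoord r)), to_X r).

Definition dlog_lambda (l dl : R) : R := dl / l.
Definition dtheta (theta dth : R) : R := dth.
(* dz / z in the coordinate z = x + i y *)
Definition omega (u v : R * R) : R[i] := cplx v / cplx u.

End quotients.
End spaces.

Arguments Hplus R p : clear implicits.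
Arguments character R p : clear implicits.
Arguments rho_fun {R} p z t.
Arguments decomposition {R p} hp e.
Arguments dlog_lambda {R} l dl.
Arguments dtheta {R} theta dth.
Arguments omega {R} u v.

(* Main.v *)
Require Import Defs.
From HB Require Import structures.
From mathcomp Require Import all_boot all_order all_algebra.
From mathcomp Require Import all_classical all_reals all_analysis.
From mathcomp Require Import complex ring lra zify.

Import Order.TTheory GRing.Theory Num.Theory.
Import numFieldNormedType.Exports.

Local Open Scope classical_set_scope.
Local Open Scope ring_scope.
Local Open Scope complex_scope.

(** A continuous character of the monoid of nonnegative elements of Z[1/p] is
    t |-> exp (z t) for exactly one complex z ([character_rho_fun],
    [rho_fun_inj]).  Choose t0 = p^-N so small that the character is close to 1
    on [0, t0], and a small z0 with exp z0 equal to its value at t0.  Dividing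
    by t |-> exp (z0 t / t0) gives a character with value 1 at t0, hence
    t0-periodic, hence everywhere close to 1; as C^x has no small subgroups
    ([no_small_subgroup]), it is trivial.  So the space of nontrivial
    characters is C^x, and the three spaces are its quotients by p^Z and by
    the positive reals, and the quotient of the positive reals by p^Z.

    All the charts used are local inverses of one global parametrization: of
    the curve by C^x, of the periodic orbit by the positive reals, and of the
    double cover by the angle.  Two points with the same image differ by a
    power of p, or by a multiple of 2 pi; both ambiguities are discrete, so
    two continuous lifts of one map differ, near a point, by a constant
    ([coordsE_rigid], [coordsC_rigid], [coordsX_rigid]).  This determines all
    changes of coordinates (z |-> p^n z, s |-> p^n s, t |-> t + 2 pi k), which
    are visibly smooth, resp. holomorphic, and preserve dz/z, ds/s and dt.  It
    also determines all local expressions of the decomposition: up to such a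
    constant, they are the modulus and a local branch of the argument.

    The decomposition z |-> (|z|, z / |z|) has the inverse
    (s, t) |-> s exp (i t), which is smooth in the coordinates, and a map with
    continuous local expressions between etale coordinates is continuous
    ([smooth_map_continuous]); hence it is a diffeomorphism.  Differentiating
    the modulus and the argument gives (x dx + y dy) / |z|^2 and
    (x dy - y dx) / |z|^2 as pullbacks of ds/s and dt: these are the real and
    imaginary parts of dz/z ([omegaE]).  A form h(z) dz is C-linear on tangent
    vectors, so its values on 1 and i determine each other; this yields both
    uniqueness statements.  For the lengths, a simple loop from s must end at
    p s, resp. s + 2 pi, since a longer one would pass through such a point
    before its end. *)

Set Implicit Arguments.
Unset Strict Implicit.
Unset Printing Implicit Defensive.

(** * Functions of class C^n *)

Section smoothness.
Context {R : realType}.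
Implicit Types V W : normedModType R.

(** Differentials are local; this is what turns the rigidity of lifts into
    formulas for pullbacks. *)
Lemma near_is_diff V W (f g : V -> W) (df : V -> W) x :
  (\forall w \near x, g w = f w) -> is_diff x f df -> is_diff x g df.
Proof.
move=> gf [dfx <-].
have gfx : g x = f x by exact: (nbhs_singleton gf).
have gE : g \o shift x = cst (g x) + 'd f x +o_ 0 id.
  apply/eqaddoP => e e0.
  have /eqaddoP/(_ e e0) H := diff_locally dfx.
  have S : \forall h \near 0, g (h + x) = f (h + x).
    by move: gf; rewrite (near_shift 0) subr0.
  apply: filterS2 S H => h Sh.
  by rewrite /= !fctE/= Sh gfx.
have dgx : 'd g x = 'd f x :> (V -> W).
  by apply: diff_unique gE; exact: diff_continuous.
split=> //; apply/diff_locallyP; rewrite dgx; split=> //.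
exact: diff_continuous.
Qed.

Lemma class_C_subset V W n (U U' : set V) (f : V -> W) :
  U' `<=` U -> class_C n U f -> class_C n U' f.
Proof.
move=> UU'; elim: n f => [|n IH] f /=; first by move=> cf u /UU'; exact: cf.
by move=> [df cf]; split=> [u /UU'|v]; [exact: df|exact/IH].
Qed.

Lemma class_C_ext V W n (U : set V) (f g : V -> W) : open U ->
  {in U, g =1 f} -> class_C n U f -> class_C n U g.
Proof.
move=> oU; elim: n f g => [|n IH] f g gf /=.
  move=> cf u Uu; have gu : g u = f u by rewrite gf ?inE.
  rewrite /prop_for/= /continuous_at gu.
  apply: cvg_trans (cf u Uu); apply: near_eq_cvg.
  have := open_nbhs_nbhs (conj oU Uu); apply: filterS => w Uw.
  by rewrite gf ?inE.
move=> [df cf].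
have D u : U u -> is_diff u g ('d f u).
  move=> Uu; apply: (@near_is_diff _ _ f); last exact/differentiableP/df.
  have := open_nbhs_nbhs (conj oU Uu); apply: filterS => w Uw.
  by rewrite gf ?inE.
split=> [u /D[]//|v]; apply: IH (cf v) => u; rewrite inE => /D[_ ->//].
Qed.

Lemma class_CS V W n (U : set V) (f : V -> W) :
  class_C n.+1 U f -> class_C n U f.
Proof.
elim: n f => [|n IH] f [df cf].
  by move=> u /df; exact: differentiable_continuous.
by split=> // v; exact/IH/cf.
Qed.

Lemma smooth_cst V W (U : set V) (a : W) : smooth_on U (cst a).
Proof.
move=> n; elim: n a => [|n IH] a /=; first by move=> u _; exact: cst_continuous.
split=> [u _|v]; first exact: differentiable_cst.
rewrite (_ : (fun u => _) = cst 0)//; apply/funext => u.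
by rewrite diff_cst.
Qed.

(** The inductive step of the smoothness proofs below: a closed formula for the
    differential has only to be of class C^n, and it is often made of functions
    that are already known to be so. *)
Lemma class_C_diff V W n (U : set V) (f : V -> W) (df : V -> V -> W) : open U ->
  (forall u, U u -> is_diff u f (df u)) ->
  (forall v, class_C n U (df^~ v)) -> class_C n.+1 U f.
Proof.
move=> oU D cf; split=> [u /D[]//|v].
by apply: class_C_ext (cf v) => // u; rewrite inE => /D[_ ->].
Qed.

Lemma is_diff_linear V W (f : V -> W) x :
  linear f -> continuous f -> is_diff x f f.
Proof.
move=> lf cf; pose lfM := GRing.isLinear.Build _ _ _ _ _ lf.
pose fL : {linear _ -> _} := HB.pack f lfM.
split; first exact: (@linear_differentiable _ _ _ fL).
by rewrite (@diff_lin _ _ _ fL).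
Qed.

Lemma smooth_linear V W (U : set V) (f : V -> W) : open U ->
  linear f -> continuous f -> smooth_on U f.
Proof.
move=> oU lf cf [|n] /=; first by move=> u _; exact: cf.
apply: (@class_C_diff _ _ _ _ _ (fun=> f)) => //.
  by move=> u _; exact: is_diff_linear.
by move=> v; exact: smooth_cst.
Qed.

Lemma class_CD V W n (U : set V) (f g : V -> W) : open U ->
  class_C n U f -> class_C n U g -> class_C n U (fun u => f u + g u).
Proof.
move=> oU; elim: n f g => [|n IH] f g.
  by move=> cf cg u Uu; apply: cvgD; [exact: cf|exact: cg].
move=> [df cf] [dg cg].
apply: (@class_C_diff _ _ _ _ _ (fun u v => 'd f u v + 'd g u v)) => //.
  move=> u Uu; apply: (is_diffD (differentiableP _) (differentiableP _)).
    exact: df.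
  exact: dg.
move=> v; apply: (IH (fun u => 'd f u v) (fun u => 'd g u v)).
  exact: cf.
exact: cg.
Qed.

Lemma class_CM V n (U : set V) (f g : V -> R) : open U ->
  class_C n U f -> class_C n U g -> class_C n U (fun u => f u * g u : R).
Proof.
move=> oU; elim: n f g => [|n IH] f g Cf Cg.
  by move=> u Uu; apply: cvgM; [exact: Cf|exact: Cg].
have [df cf] := Cf; have [dg cg] := Cg.
apply: (@class_C_diff _ _ _ _ _
  (fun u v => f u * 'd g u v + g u * 'd f u v : R)) => //.
  move=> u Uu; apply: (is_diffM (differentiableP _) (differentiableP _)).
    exact: df.
  exact: dg.
move=> v; apply: class_CD => //.
  by apply: (IH f (fun u => 'd g u v)); [exact: class_CS|exact: cg].
by apply: (IH g (fun u => 'd f u v)); [exact: class_CS|exact: cf].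
Qed.

Lemma is_diff_inv V (f df : V -> R) x : is_diff x f df -> f x != 0 ->
  is_diff x (fun y => (f y)^-1) (fun h => - (f x) ^- 2 * df h).
Proof.
move=> [Df <-] fx0; split; first exact: differentiableV.
by rewrite diffV.
Qed.

Lemma class_CV V n (U : set V) (f : V -> R) : open U ->
  (forall u, U u -> f u != 0) ->
  class_C n U f -> class_C n U (fun u => (f u)^-1 : R).
Proof.
move=> oU f0; elim: n => [|n IH] Cf.
  by move=> u Uu; apply: cvgV; [exact: f0|exact: Cf].
have [df cf] := Cf.
apply: (@class_C_diff _ _ _ _ _
  (fun u v => (-1 * ((f u)^-1 * (f u)^-1)) * 'd f u v : R)) => //.
  move=> u Uu; have D := is_diff_inv (differentiableP (df u Uu)) (f0 u Uu).
  by apply: (is_diff_eq D); apply/funext => v; rewrite mulN1r -invfM -expr2.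
have CV := IH (class_CS Cf).
move=> v; apply: class_CM => //; last exact: cf.
by apply: class_CM => //; [exact: smooth_cst|exact: class_CM].
Qed.

Lemma class_C_pair V W W' n (U : set V) (f : V -> W) (g : V -> W') : open U ->
  class_C n U f -> class_C n U g -> class_C n U (fun u => (f u, g u)).
Proof.
move=> oU; elim: n f g => [|n IH] f g.
  by move=> cf cg u Uu; apply: cvg_pair; [exact: cf|exact: cg].
move=> [df cf] [dg cg].
apply: (@class_C_diff _ _ _ _ _ (fun u v => ('d f u v, 'd g u v))) => //.
  move=> u Uu; apply: (is_diff_pair (differentiableP _) (differentiableP _)).
    exact: df.
  exact: dg.
move=> v; apply: (IH (fun u => 'd f u v) (fun u => 'd g u v)).
  exact: cf.
exact: cg.
Qed.

Lemma smooth_near_ext V W (f g : V -> W) u :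
  (\forall w \near u, g w = f w) -> smooth_near u f -> smooth_near u g.
Proof.
move=> gf [U [oU Uu sf]].
have := gf; rewrite /prop_near1 nbhsE => -[U' [oU' U'u] gfU'].
exists (U `&` U'); split; [exact: openI|by []|move=> n].
have oI : open (U `&` U') by exact: openI.
apply: (@class_C_ext _ _ _ _ f) => //; last exact: class_C_subset (sf n).
by move=> w; rewrite inE => -[_ /gfU'].
Qed.

Lemma smooth_near_continuous V W (f : V -> W) u :
  smooth_near u f -> {for u, continuous f}.
Proof. by move=> [U [oU Uu sf]]; exact: (sf 0%N). Qed.

Lemma smooth_near_linear V W (f : V -> W) u :
  linear f -> continuous f -> smooth_near u f.
Proof.
move=> lf cf; exists setT; split=> //; first exact: openT.
by apply: smooth_linear => //; exact: openT.
Qed.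

Lemma smooth_near_id V (u : V) : smooth_near u id.
Proof. by apply: smooth_near_linear => // v; exact: cvg_id. Qed.

Lemma linear_scale V (a : R) : linear (fun u : V => a *: u).
Proof. by move=> k u v; rewrite scalerDr !scalerA mulrC. Qed.

Lemma smooth_near_scale V (a : R) (u : V) : smooth_near u (fun w => a *: w).
Proof.
by apply: smooth_near_linear; [exact: linear_scale|exact: scaler_continuous].
Qed.

Lemma is_diff_translate (x c : R) : is_diff x (fun w => w + c) id.
Proof. by have := is_diffD (is_diff_id x) (is_diff_cst c x); rewrite addr0. Qed.

Lemma smooth_near_translate (x c : R) : smooth_near x (fun w : R => w + c).
Proof.
exists setT; split=> //; first exact: openT.
move=> n; apply: class_CD; [exact: openT| |exact: smooth_cst].
by apply: smooth_linear; [exact: openT|by []|move=> y; exact: cvg_id].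
Qed.

(** The chain rule with a function of one real variable outside. *)
Lemma is_diff_derive V (f : V -> R) (g : R -> R) u (df : V -> R) (g' : R) :
  is_diff u f df -> is_derive (f u) 1 g g' ->
  is_diff u (g \o f) (fun v => g' * df v).
Proof.
move=> [Df df_] [Dg dg].
have Dg' : differentiable g (f u) by apply/derivable1_diffP.
split; first exact: differentiable_comp.
rewrite diff_comp// diff1E// df_; apply/funext => v /=.
by rewrite derive1E dg mulrC.
Qed.

End smoothness.

(** * The complex exponential *)

Section complex.
Context {R : realType}.
Implicit Types (z w : R[i]) (u : R * R) (t : R).

Lemma cplxK : cancel (@cplx R) cart.
Proof. by case. Qed.

Lemma cartK : cancel (@cart R) cplx.
Proof. by case. Qed.

Lemma cplx_eq0 u : (cplx u == 0) = (u == 0).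
Proof. by rewrite -(can_eq cplxK). Qed.

Lemma cmodE z : `|z| = (cmod z)%:C.
Proof. by case: z => x y; rewrite normc_def. Qed.

Lemma cmodM z w : cmod (z * w) = cmod z * cmod w.
Proof. exact: Normc.normcM. Qed.

Lemma cmod_ge0 z : 0 <= cmod z.
Proof. by rewrite -ler0c -cmodE. Qed.

Lemma cmod_gt0 z : (0 < cmod z) = (z != 0).
Proof. by rewrite -normr_gt0 cmodE -[0 in RHS](rmorph0 (real_complex R)) ltcR. Qed.

Lemma cmodC (r : R) : cmod r%:C = `|r|.
Proof. by rewrite /cmod/= expr0n addr0 sqrtr_sqr. Qed.

Lemma cmodD z w : cmod (z + w) <= cmod z + cmod w.
Proof. exact: (@le_normcD R z w). Qed.

Lemma cmodN z : cmod (- z) = cmod z.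
Proof. exact: (@normcN R z). Qed.

Lemma Re_le_cmod z : `|complex.Re z| <= cmod z.
Proof. by rewrite -lecR -cmodE normc_ge_Re. Qed.

Lemma Im_le_cmod z : `|complex.Im z| <= cmod z.
Proof.
by case: z => x y; rewrite /cmod/= -(sqrtr_sqr y) ler_wsqrtr// lerDr sqr_ge0.
Qed.

Lemma cplx_dist (z w : R[i]) (e : R) :
  (`|z - w| < e%:C) = (cmod (z - w) < e).
Proof. by rewrite cmodE ltcR. Qed.

(** The radii of the balls of R[i] are themselves complex numbers, which happen
    to be real; real radii suffice. *)
Lemma cvg_complexP (T : Type) (F : set_system T) {FF : Filter F}
    (f : T -> (R[i])^o) (z : R[i]) :
  (f x @[x --> F] --> (z : (R[i])^o)) <->
  forall e : R, 0 < e -> \forall x \near F, cmod (z - f x) < e.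
Proof.
split=> [/cvgrPdist_lt H e e0|H].
  have e0' : (0 < e%:C :> R[i]) by rewrite ltcR.
  have := H _ e0'; apply: filterS => x.
  by rewrite cplx_dist.
apply/cvgrPdist_lt => e e0.
have /complex_realP[r er] : e \is Num.real by rewrite gtr0_real.
rewrite er ltcR in e0; have := H _ e0; apply: filterS => x.
by rewrite er cplx_dist.
Qed.

Lemma near_cmod z (e : R) : 0 < e ->
  \forall w \near (z : (R[i])^o), cmod (z - w) < e.
Proof.
move=> e0; have e0' : (0 < e%:C :> R[i]) by rewrite ltcR.
have := @nbhsx_ballx _ _ (z : (R[i])^o) _ e0'.
apply: filterS => w.
by rewrite /ball/= cplx_dist.
Qed.

Lemma nbhs_cmodP z (A : set R[i]) : nbhs (z : (R[i])^o) A ->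
  exists2 e : R, 0 < e & forall w, cmod (z - w) < e -> A w.
Proof.
rewrite -nbhs_ballE => -[e /= e0 eA].
have /complex_realP[r er] : e \is Num.real by rewrite gtr0_real.
rewrite er ltcR in e0; exists r => // w wr; apply: eA.
by rewrite /ball/= er cplx_dist.
Qed.

Lemma cvg_Re (T : Type) (F : set_system T) {FF : Filter F}
    (f : T -> (R[i])^o) (z : R[i]) : f x @[x --> F] --> (z : (R[i])^o) ->
  complex.Re (f x) @[x --> F] --> complex.Re z.
Proof.
move=> /cvg_complexP H; apply/cvgrPdist_lt => e /H; apply: filterS => x.
apply: le_lt_trans.
by case: z (f x) {H} => [a b] [c d]; exact: (Re_le_cmod (_ +i* _)).
Qed.

Lemma cvg_Im (T : Type) (F : set_system T) {FF : Filter F}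
    (f : T -> (R[i])^o) (z : R[i]) : f x @[x --> F] --> (z : (R[i])^o) ->
  complex.Im (f x) @[x --> F] --> complex.Im z.
Proof.
move=> /cvg_complexP H; apply/cvgrPdist_lt => e /H; apply: filterS => x.
apply: le_lt_trans.
by case: z (f x) {H} => [a b] [c d]; exact: (Im_le_cmod (_ +i* _)).
Qed.

Lemma continuous_cart : continuous (cart : (R[i])^o -> R * R).
Proof.
move=> z; have Fz := nbhs_filter (z : (R[i])^o).
have cRe := @cvg_Re _ _ Fz id z cvg_id; have cIm := @cvg_Im _ _ Fz id z cvg_id.
exact: (@cvg_pair _ _ _ _ _ _ Fz _ _ _ _ cRe cIm).
Qed.

Lemma cmod_le z : cmod z <= `|complex.Re z| + `|complex.Im z|.
Proof.
case: z => x y; rewrite -[leRHS]ger0_norm ?addr_ge0// -sqrtr_sqr ler_wsqrtr//.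
rewrite /= sqrrD !real_normK ?num_real// -addrA lerD2l lerDr.
by rewrite mulrn_wge0// mulr_ge0.
Qed.

Lemma continuous_cplx : continuous (cplx : R * R -> (R[i])^o).
Proof.
move=> u; apply/cvg_complexP => e e0.
have e20 : 0 < e / 2 by rewrite divr_gt0.
have /cvgrPdist_lt/(_ _ e20) H1 : fst w @[w --> u] --> fst u by exact: cvg_fst.
have /cvgrPdist_lt/(_ _ e20) H2 : snd w @[w --> u] --> snd u by exact: cvg_snd.
near=> w; apply: le_lt_trans (cmod_le _) _; rewrite (splitr e) ltrD//.
  by rewrite /=; near: w; exact: H1.
by rewrite /=; near: w; exact: H2.
Unshelve. all: by end_near. Qed.

Definition cis t : R[i] := cos t +i* sin t.

Lemma cexp_imag t : cexp (0 +i* t) = cis t.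
Proof. by rewrite /cexp/= expR0 !mul1r. Qed.

Lemma cexpE z : cexp z = (expR (complex.Re z))%:C * cis (complex.Im z).
Proof. by rewrite /cexp /cis; simpc. Qed.

Lemma cisD s t : cis (s + t) = cis s * cis t.
Proof.
rewrite /cis cosD sinD; apply/eqP; rewrite eq_complex /=.
by apply/andP; split; apply/eqP; ring.
Qed.

Lemma cmod_cis t : cmod (cis t) = 1.
Proof. by rewrite /cmod/= cos2Dsin2 sqrtr1. Qed.

Lemma cis0 : cis 0 = 1.
Proof. by rewrite /cis cos0 sin0. Qed.

Lemma cis_neq0 t : cis t != 0.
Proof. by rewrite -cmod_gt0 cmod_cis. Qed.

Lemma cexpD z w : cexp (z + w) = cexp z * cexp w.
Proof.
by case: z w => [a b] [c d]; rewrite !cexpE/= expRD cisD rmorphM/= mulrACA.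
Qed.

Lemma cexp0 : cexp (0 : R[i]) = 1.
Proof. by rewrite cexpE/= expR0 cis0 mul1r. Qed.

Lemma cmod_cexp z : cmod (cexp z) = expR (complex.Re z).
Proof. by rewrite cexpE cmodM cmod_cis cmodC mulr1 ger0_norm ?expR_ge0. Qed.

Lemma cexp_neq0 z : cexp z != 0.
Proof. by rewrite -cmod_gt0 cmod_cexp expR_gt0. Qed.

Lemma continuous_cis : continuous (cis : R -> (R[i])^o).
Proof.
move=> t; rewrite (_ : cis = cplx \o (fun t => (cos t, sin t)))//.
apply: continuous_comp; last exact: continuous_cplx.
exact: (cvg_pair (@continuous_cos R t) (@continuous_sin R t)).
Qed.

Lemma continuous_cexp : continuous (@cexp R : (R[i])^o -> (R[i])^o).
Proof.
rewrite (_ : @cexp R = (fun u => cplx (expR u.1 * cos u.2, expR u.1 * sin u.2))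
  \o cart)// => w.
apply: continuous_comp; first exact: continuous_cart.
apply: (@continuous_comp _ _ _ (fun u : R * R =>
    (expR u.1 * cos u.2, expR u.1 * sin u.2))); last exact: continuous_cplx.
have E : {for cart w, continuous (fun u : R * R => expR u.1)}.
  by apply: continuous_comp; [exact: cvg_fst|exact: continuous_expR].
have C : {for cart w, continuous (fun u : R * R => cos u.2)}.
  by apply: continuous_comp; [exact: cvg_snd|exact: continuous_cos].
have S : {for cart w, continuous (fun u : R * R => sin u.2)}.
  by apply: continuous_comp; [exact: cvg_snd|exact: continuous_sin].
exact: (cvg_pair (cvgM E C) (cvgM E S)).
Qed.

Lemma cis_2pi (k : int) : cis (2 * pi * k%:~R) = 1.
Proof.
have nat_case (n : nat) : cis (2 * pi * n%:R) = 1.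
  elim: n => [|n IH]; first by rewrite mulr0 cis0.
  rewrite -[n.+1%:R]natr1 mulrDr cisD IH mul1r mulr1 /cis mulr_natl cos2pi sin2pi.
  by [].
case: k => n; first exact: nat_case.
have := cisD (2 * pi * (Negz n)%:~R) (2 * pi * n.+1%:R).
by rewrite nat_case mulr1 NegzE mulrNz mulrN addNr cis0.
Qed.

(** Reduce t modulo 2 pi to s in [0, 2 pi).  Then cos s = 1 - 2 sin^2 (s / 2)
    forces sin (s / 2) = 0, and the sine has no zero in (0, pi). *)
Lemma cis_eq1 t : cis t = 1 -> exists k : int, t = 2 * pi * k%:~R.
Proof.
move=> t1.
have pi0 := @pi_gt0 R.
pose k := Num.floor (t / (2 * pi)).
pose s := t - 2 * pi * k%:~R.
have s1 : cis s = 1.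
  by rewrite /s cisD t1 mul1r -mulrN -mulrNz cis_2pi.
have tp : 0 < 2 * pi :> R by rewrite mulr_gt0.
have s0 : 0 <= s.
  by rewrite subr_ge0 mulrC -ler_pdivlMr// Num.Theory.floor_le.
have s2 : s < 2 * pi.
  rewrite ltrBlDr -{1}[2 * pi]mulr1 -mulrDr mulrC -ltr_pdivrMr//.
  by rewrite addrC -[1]/(1%:~R) -intrD floorD1_gt.
exists k; apply/eqP; rewrite -subr_eq0 -/s; apply/eqP/le_anti; rewrite s0 andbT.
rewrite leNgt; apply/negP => sp.
have /sin_gt0_pi : 0 < s / 2 < pi.
  by rewrite divr_gt0//= ltr_pdivrMr// mulrC.
have : cos s = 1 by case: s1.
rewrite [in cos _](splitr s) cosD -!expr2 cos2sin2 -addrA -opprD => /eqP.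
rewrite addrC -subr_eq0 addrK oppr_eq0 -mulr2n mulrn_eq0/= sqrf_eq0 => /eqP->.
by rewrite ltxx.
Qed.

Lemma cis_eq s t : cis s = cis t <-> exists k : int, s = t + 2 * pi * k%:~R.
Proof.
split=> [st|[k ->]]; last by rewrite cisD cis_2pi mulr1.
have [k kE] : exists k : int, s - t = 2 * pi * k%:~R.
  apply: cis_eq1; apply: (mulIf (cis_neq0 t)).
  by rewrite -cisD subrK mul1r.
by exists k; rewrite -kE addrC subrK.
Qed.

Lemma polar z : exists t, z = (cmod z)%:C * cis t.
Proof.
have [->|z0] := eqVneq z 0; first by exists 0; rewrite /cmod Normc.normc0 mul0r.
have r0 : 0 < cmod z by rewrite cmod_gt0.
have r2 : cmod z ^+ 2 = complex.Re z ^+ 2 + complex.Im z ^+ 2.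
  by case: z {z0 r0} => x y; rewrite sqr_sqrtr ?addr_ge0 ?sqr_ge0.
pose c := complex.Re z / cmod z; pose s := complex.Im z / cmod z.
have cs : c ^+ 2 + s ^+ 2 = 1.
  by rewrite !expr_div_n -mulrDl -r2 divff// expf_neq0// gt_eqF.
have c1 : -1 <= c <= 1.
  by rewrite -ler_norml -(@expr_le1 _ 2)// real_normK ?num_real// -cs lerDl sqr_ge0.
suff [t [ct st]] : exists t, cos t = c /\ sin t = s.
  exists t; rewrite /cis ct st; case: (z) r0 @c @s {cs c1 ct st r2} => x y r0 /=.
  simpc; rewrite ![_ * (_ / _)]mulrC !divfK//; exact: lt0r_neq0.
have sq : Num.sqrt (1 - c ^+ 2) = `|s|.
  by rewrite -cs addrAC subrr add0r sqrtr_sqr.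
have [s0|s0] := leP 0 s.
  by exists (acos c); rewrite acosK// sin_acos// sq ger0_norm.
by exists (- acos c); rewrite cosN sinN acosK// sin_acos// sq ltr0_norm// opprK.
Qed.

End complex.

(** * Local polar coordinates *)

Section polar_coordinates.
Context {R : realType}.
Implicit Types (u v : R * R) (t : R).

Definition sqnorm u : R := u.1 * u.1 + u.2 * u.2.

Definition radius u : R := Num.sqrt (sqnorm u).

Definition halfplane t : set (R * R) :=
  [set u | 0 < cos t * u.1 + sin t * u.2].

(** The branch of the argument on the half-plane centred at direction t that
    takes the value t there: rotate by -t, which makes the real part positive,
    and use the arctangent. *)
Definition local_arg t u : R :=
  t + atan ((cos t * u.2 - sin t * u.1) * (cos t * u.1 + sin t * u.2)^-1).

Lemma cmod_cplx u : cmod (cplx u) = radius u.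
Proof. by rewrite /radius /sqnorm -!expr2. Qed.

Lemma sqnorm_gt0 u : (0 < sqnorm u) = (u != 0).
Proof.
case: u => x y; rewrite lt_def addr_ge0 -?expr2 ?sqr_ge0// andbT /sqnorm/= -!expr2.
by rewrite paddr_eq0 ?sqr_ge0// !sqrf_eq0.
Qed.

Lemma radius_gt0 u : (0 < radius u) = (u != 0).
Proof. by rewrite sqrtr_gt0 sqnorm_gt0. Qed.

Lemma sqr_radius u : radius u ^+ 2 = sqnorm u.
Proof. by rewrite sqr_sqrtr// /sqnorm -!expr2 addr_ge0 ?sqr_ge0. Qed.

Lemma halfplane_neq0 t u : halfplane t u -> u != 0.
Proof.
by apply: contraPneq => ->; rewrite /halfplane/= !mulr0 addr0 ltxx.
Qed.

(** With a + i b the rotated point, cos (atan (b / a)) = a / |u| and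
    sin (atan (b / a)) = b / |u| as a > 0; rotating back gives u. *)
Lemma polar_local_arg t u :
  halfplane t u -> cplx u = (radius u)%:C * cis (local_arg t u).
Proof.
move=> h; have u0 := halfplane_neq0 h; move: h; rewrite /halfplane/=.
have r0 : 0 < radius u by rewrite radius_gt0.
rewrite /local_arg; set a := _ + _; set b := _ - _ => a0.
have ab : a ^+ 2 + b ^+ 2 = radius u ^+ 2.
  rewrite sqr_radius (_ : _ + _ = (cos t ^+ 2 + sin t ^+ 2) * sqnorm u).
    by rewrite cos2Dsin2 mul1r.
  by rewrite /a /b /sqnorm; ring.
have c : cos (atan (b * a^-1)) = a / radius u.
  rewrite cos_atan (_ : 1 + _ = (radius u / a) ^+ 2).
    by rewrite sqrtr_sqr ger0_norm ?divr_ge0 ?invf_div// ltW.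
  by rewrite !expr_div_n -ab; field; rewrite gt_eqF.
have s : sin (atan (b * a^-1)) = b / radius u.
  have := atanK (b * a^-1); rewrite /tan c => /eqP.
  rewrite eqr_div ?lt0r_neq0 ?divr_gt0// => /eqP e.
  by apply: (mulIf (lt0r_neq0 a0)); rewrite e mulrA mulrAC.
rewrite cisD; apply/eqP; rewrite eq_complex/= c s; simpc.
have cs := cos2Dsin2 t.
apply/andP; split; apply/eqP.
  rewrite [RHS](_ : _ = (cos t * a - sin t * b) * (radius u / radius u));
    last by ring.
  rewrite divff ?gt_eqF// mulr1 /a /b.
  rewrite [RHS](_ : _ = (cos t ^+ 2 + sin t ^+ 2) * u.1); last by ring.
  by rewrite cs mul1r.
rewrite [RHS](_ : _ = (cos t * b + sin t * a) * (radius u / radius u));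
    last by ring.
rewrite divff ?gt_eqF// mulr1 /a /b.
rewrite [RHS](_ : _ = (cos t ^+ 2 + sin t ^+ 2) * u.2); last by ring.
by rewrite cs mul1r.
Qed.

(** Provides a branch of the argument near any nonzero point, with a prescribed
    value there. *)
Lemma halfplane_polar u t : u != 0 -> cplx u = (radius u)%:C * cis t ->
  halfplane t u /\ local_arg t u = t.
Proof.
rewrite -radius_gt0; case: u => x y; move: (radius _) => r r0 [].
rewrite !mul0r subr0 addr0 => -> ->; rewrite /halfplane/= /local_arg /=; split.
  rewrite (_ : _ + _ = r * (cos t ^+ 2 + sin t ^+ 2)); last by ring.
  by rewrite cos2Dsin2 mulr1.
by rewrite (_ : _ - _ = 0) ?mul0r ?atan0 ?addr0//; ring.
Qed.

Lemma smooth_fst (U : set (R * R)) : open U -> smooth_on U (@fst R R).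
Proof.
by move=> oU; apply: smooth_linear => // u; exact: cvg_fst.
Qed.

Lemma smooth_snd (U : set (R * R)) : open U -> smooth_on U (@snd R R).
Proof.
by move=> oU; apply: smooth_linear => // u; exact: cvg_snd.
Qed.

Lemma is_diff_fst u : is_diff u (@fst R R) fst.
Proof. by apply: is_diff_linear => // w; exact: cvg_fst. Qed.

Lemma is_diff_snd u : is_diff u (@snd R R) snd.
Proof. by apply: is_diff_linear => // w; exact: cvg_snd. Qed.

Lemma is_diff_sqnorm u :
  is_diff u sqnorm (fun v => 2 * (u.1 * v.1 + u.2 * v.2)).
Proof.
have D := is_diffD (is_diffM (is_diff_fst u) (is_diff_fst u))
  (is_diffM (is_diff_snd u) (is_diff_snd u)).
apply: (is_diff_eq D); apply/funext => v.
by rewrite /= !fctE /= -![_ *: _]/(_ * _); ring.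
Qed.

Lemma is_diff_radius u : u != 0 ->
  is_diff u radius (fun v => (u.1 * v.1 + u.2 * v.2) * (radius u)^-1).
Proof.
rewrite -sqnorm_gt0 => u0.
have D := is_diff_derive (is_diff_sqnorm u) (is_derive1_sqrt u0).
apply: (is_diff_eq D); apply/funext => v; rewrite sqnorm_gt0 in u0.
by rewrite -/(radius u); field; rewrite gt_eqF ?radius_gt0.
Qed.

(** The branch t appears neither in the differential nor in its domain of
    definition: this is why the angular form is global although the angle is
    not.  The factor -1 is kept apart to match the products of smooth
    functions that occur here. *)
Lemma is_diff_local_arg t u : halfplane t u ->
  is_diff u (local_arg t)
    (fun v => (u.1 * v.2 + (-1 * u.2) * v.1) * (sqnorm u)^-1).
Proof.
move=> h; have u0 := halfplane_neq0 h; move: h; rewrite /halfplane/= => a0.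
have D1 := is_diff_fst u; have D2 := is_diff_snd u.
have Da := is_diffD (is_diffZ (cos t) D1) (is_diffZ (sin t) D2).
have Db := is_diffB (is_diffZ (cos t) D2) (is_diffZ (sin t) D1).
have Dq := is_diffM Db (is_diff_inv Da (lt0r_neq0 a0)).
have D := is_diffD (is_diff_cst t u) (is_diff_derive Dq (is_derive1_atan _)).
apply: (is_diff_eq D); apply/funext => v.
rewrite !fctE /= -![_ *: _]/(_ * _).
rewrite -sqnorm_gt0 /sqnorm in u0 *.
have cs := cos2Dsin2 t.
set a := cos t * u.1 + _ in a0 *; set b := cos t * u.2 - _.
have ab : a ^+ 2 + b ^+ 2 = u.1 * u.1 + u.2 * u.2.
  rewrite (_ : _ + _ = (cos t ^+ 2 + sin t ^+ 2) * (u.1 * u.1 + u.2 * u.2)).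
    by rewrite cs mul1r.
  by rewrite /a /b; ring.
have E : 1 + (b / a) ^+ 2 = (u.1 * u.1 + u.2 * u.2) / a ^+ 2.
  by rewrite -ab; field; rewrite gt_eqF.
rewrite E (_ : u.1 * v.2 + -1 * u.2 * v.1 =
    (cos t ^+ 2 + sin t ^+ 2) * (u.1 * v.2 + -1 * u.2 * v.1)); last first.
  by rewrite cs mul1r.
rewrite (_ : _ * (_ * v.2 + _) = a * (cos t * v.2 - sin t * v.1) -
  b * (cos t * v.1 + sin t * v.2)); last by rewrite /a /b; ring.
rewrite add0r -ab; field.
by rewrite ab !gt_eqF.
Qed.

Lemma open_neq0 : open [set u : R * R | u != 0].
Proof.
rewrite (_ : [set u | _] = ~` [set 0]); last first.
  by apply/seteqP; split=> u /= /eqP.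
exact/closed_openC/accessible_closed_set1/hausdorff_accessible/norm_hausdorff.
Qed.

Lemma open_halfplane t : open (halfplane t).
Proof.
pose f u : R := cos t * u.1 + sin t * u.2.
have cf : continuous f.
  move=> u; apply: cvgD.
    by apply: (@cvgMl_tmp); exact: cvg_fst.
  by apply: cvgMl_tmp; exact: cvg_snd.
by apply: (@open_comp _ _ f [set x | 0 < x]) => //; exact: open_gt.
Qed.

Lemma class_C_dot n (U : set (R * R)) (f g : R * R -> R) v : open U ->
  class_C n U f -> class_C n U g -> class_C n U (fun u => f u * v.1 + g u * v.2).
Proof.
move=> oU Cf Cg.
by apply: class_CD => //; apply: class_CM => //; exact: smooth_cst.
Qed.

(** The differential of the radius involves only its inverse and linear
    functions, so the induction on the class feeds on itself. *)
Lemma smooth_radius : smooth_on [set u | u != 0] radius.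
Proof.
have oU := open_neq0.
elim=> [|n IH].
  move=> u u0; apply: differentiable_continuous.
  by have [] := is_diff_radius u0.
apply: class_C_diff is_diff_radius _ => // v.
apply: class_CM => //.
  by apply: class_C_dot => //; [exact: smooth_fst|exact: smooth_snd].
by apply: class_CV => // u; rewrite -radius_gt0 => /lt0r_neq0.
Qed.

Lemma smooth_sqnorm (U : set (R * R)) : open U -> smooth_on U sqnorm.
Proof.
by move=> oU n; apply: class_CD => //; apply: class_CM => //;
  (exact: smooth_fst || exact: smooth_snd).
Qed.

Lemma smooth_local_arg t : smooth_on (halfplane t) (local_arg t).
Proof.
have oU := @open_halfplane t.
case=> [|n].
  move=> u u0; apply: differentiable_continuous.
  by have [] := is_diff_local_arg u0.
apply: class_C_diff (fun u => @is_diff_local_arg t u) _ => // v.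
apply: class_CM => //; last first.
  apply: class_CV => //; last exact: smooth_sqnorm.
  by move=> u /halfplane_neq0; rewrite -sqnorm_gt0 => /lt0r_neq0.
apply: class_CD => //; apply: class_CM => //; try exact: smooth_cst.
  exact: smooth_fst.
by apply: class_CM => //; [exact: smooth_cst|exact: smooth_snd].
Qed.

End polar_coordinates.

(** * Characters of the monoid *)

Lemma nbhs_initialP (S : choiceType) (T : topologicalType) (f : S -> T)
    (x : initial_topology f) (A : set (initial_topology f)) :
  nbhs x A <-> exists2 B, nbhs (f x) B & f @^-1` B `<=` A.
Proof.
split=> [[_ [[B oB <-] Bx BA]]|[B + BA]].
  by exists B => //; exact: (open_nbhs_nbhs (conj oB Bx)).
rewrite nbhsE => -[C [oC Cx] CB].
exists (f @^-1` C); split => //; first by exists C.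
by move=> y Cy; apply/BA/CB.
Qed.

Section characters.
Context {R : realType} (p : nat) (hp : prime p).
Implicit Types (z w : R[i]) (s t : R).
Local Notation H := (Hplus R p).

Lemma p_gt1 : 1 < p%:R :> R.
Proof. by rewrite ltr1n prime_gt1. Qed.

Lemma pX_gt0 n : 0 < p%:R ^+ n :> R.
Proof. by rewrite exprn_gt0// (lt_trans _ p_gt1). Qed.

Lemma Hplus0 : H 0.
Proof. by split => //; exists 0, 0%N; rewrite mul0r. Qed.

Lemma HplusV n : H (p%:R ^+ n)^-1.
Proof.
by split; [rewrite invr_ge0 ltW ?pX_gt0|exists 1, n; rewrite mul1r].
Qed.

Lemma HplusB (s t : R) : H s -> H t -> t <= s -> H (s - t).
Proof.
move=> [s0 [k [m sE]]] [t0 [l [n tE]]] ts; split; first by rewrite subr_ge0.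
exists (k * p%:Z ^+ n - l * p%:Z ^+ m), (m + n)%N.
rewrite sE tE !rmorphB !rmorphM !rmorphXn /= -!pmulrn exprD.
by field; rewrite !gt_eqF ?pX_gt0.
Qed.

Lemma HplusD (s t : R) : H s -> H t -> H (s + t).
Proof.
move=> [s0 [k [m sE]]] [t0 [l [n tE]]]; split; first by rewrite addr_ge0.
exists (k * p%:Z ^+ n + l * p%:Z ^+ m), (m + n)%N.
rewrite sE tE !rmorphD !rmorphM !rmorphXn /= -!pmulrn exprD.
by field; rewrite !gt_eqF ?pX_gt0.
Qed.

Lemma HplusMn (s : R) n : H s -> H (s *+ n).
Proof.
move=> Hs; elim: n => [|n IH]; first by rewrite mulr0n; exact: Hplus0.
by rewrite mulrS; exact: HplusD.
Qed.

(** The monoid is dense near 0, which is what makes continuity at 0 useful. *)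
Lemma Hplus_small (e : R) : 0 < e -> exists n, (p%:R ^+ n)^-1 < e.
Proof.
move=> e0; exists (Num.trunc e^-1).+1.
rewrite invf_plt ?posrE ?pX_gt0//.
have e1 : 0 <= e^-1 by rewrite invr_ge0 ltW.
have := truncnS_gt e^-1; move=> /lt_le_trans; apply.
rewrite -natrX ler_nat ltnW// ltn_expl// prime_gt1//.
Qed.

Lemma rho_fun_continuous z :
  continuous (rho_fun p z : (H : topologicalType) -> (R[i])^o).
Proof.
pose f (s : R) : (R[i])^o := cexp (z * s%:C).
have cf : continuous f.
  move=> s; apply: (@continuous_comp _ _ _ (fun s : R => z * s%:C : (R[i])^o)
    (@cexp R : (R[i])^o -> (R[i])^o)); last exact: continuous_cexp.
  apply: (@continuous_comp _ _ _ (fun s : R => s%:C : (R[i])^o)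
    ( *%R z : (R[i])^o -> (R[i])^o)); first exact: real_complex_continuous.
  exact: (@mulrl_continuous R[i]).
move=> s; apply: (@continuous_comp _ _ _ (\val : H -> R) f); last exact: cf.
exact: initial_continuous.
Qed.

(** If exp (d t) = 1 for all t in the monoid, the value t = 1 gives Re d = 0;
    then (Im d) t is a multiple of 2 pi for arbitrarily small t > 0, so that
    Im d = 0. *)
Lemma rho_fun_inj : injective (@rho_fun R p).
Proof.
move=> z w zw.
have E (s : R) : H s -> cexp (z * s%:C) = cexp (w * s%:C).
  by move=> Hs; have := congr1 (fun f => f (exist _ s (mem_set Hs))) zw.
pose d := z - w.
have D (s : R) : H s -> cexp (d * s%:C) = 1.
  move=> Hs; apply: (mulIf (cexp_neq0 (w * s%:C))).
  by rewrite -cexpD -mulrDl subrK E// mul1r.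
apply/eqP; rewrite -subr_eq0 -/d; apply/eqP.
have Re0 : complex.Re d = 0.
  have H1 : H 1 by rewrite -invr1 -[1](expr0 p%:R); exact: HplusV.
  have := congr1 (@cmod R) (D _ H1); rewrite cmod_cexp mulr1 (cmodC 1) normr1.
  by rewrite -[RHS]expR0 => /expR_inj.
have Im0 : complex.Im d = 0.
  apply/eqP/negPn/negP => y0.
  have e0 : 0 < pi / `|complex.Im d|.
    by rewrite divr_gt0 ?pi_gt0 ?normr_gt0.
  have [n nE] := Hplus_small e0.
  have := D _ (HplusV n); rewrite cexpE.
  set s := (p%:R ^+ n)^-1 in nE *; have s0 : 0 < s by rewrite invr_gt0 pX_gt0.
  rewrite (_ : d * s%:C = 0 +i* (complex.Im d * s)); last first.
    by case: (d) Re0 => x y /= ->; simpc.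
  rewrite /= expR0 mul1r => /cis_eq1[k kE].
  have : `|complex.Im d * s| < 2 * pi.
    rewrite normrM (gtr0_norm s0) mulrC.
    rewrite ltr_pdivlMr ?normr_gt0// in nE; apply: lt_trans nE _.
    by rewrite ltr_pMl ?pi_gt0// ltr1n.
  rewrite kE normrM ger0_norm ?mulr_ge0 ?pi_ge0// gtr_pMr ?mulr_gt0 ?pi_gt0//.
  rewrite -intr_norm -[1]/(1%:~R) ltr_int => k1.
  have k0 : k = 0 by lia.
  move/eqP: kE; rewrite k0 mulr0 mulf_eq0 (negPf y0)/=.
  by rewrite gt_eqF.
by case: (d) Re0 Im0 => x y /= -> ->.
Qed.

Lemma rho_fun_character z : z != 0 -> character R p (rho_fun p z).
Proof.
move=> z0; split.
- by move=> t t0; rewrite /rho_fun t0 mulr0 cexp0.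
- by move=> s t r e; rewrite /rho_fun e rmorphD mulrDr cexpD.
- exact: rho_fun_continuous.
- apply: contrapT => /forallNP N; move/eqP: z0; apply; apply: rho_fun_inj.
  apply/funext => t; rewrite {2}/rho_fun mul0r cexp0.
  by have /negP := N t; rewrite negbK => /eqP.
Qed.

End characters.

Section classification.
Context {R : realType} (p : nat) (hp : prime p).
Implicit Types (z w : R[i]) (s t : R).
Local Notation H := (Hplus R p).

(** A logarithm near 1, with small values: ln |w| + i arg w. *)
Lemma cexp_near1 (e : R) : 0 < e ->
  \forall w \near (1 : (R[i])^o), exists2 z, cexp z = w & cmod z < e.
Proof.
move=> e0; pose u1 : R * R := (1, 0).
have u1h : halfplane 0 u1 by rewrite /halfplane/= cos0 mulr1 sin0 mulr0 addr0.
have u10 := halfplane_neq0 u1h.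
have r1 : radius u1 = 1 by rewrite /radius /sqnorm /= !mulr1 mulr0 addr0 sqrtr1.
have a1 : local_arg 0 u1 = 0.
  by rewrite /local_arg /= sin0 cos0 mulr0 mul0r subrr mul0r atan0 addr0.
have c1 : ln (radius w) @[w --> u1] --> (0 : R).
  rewrite -(@ln1 R) -r1; apply: continuous_comp.
    exact: (smooth_radius 0%N).
  by apply: continuous_ln; rewrite r1.
have c2 : local_arg 0 w @[w --> u1] --> (0 : R).
  by rewrite -[X in _ --> X]a1; exact: (@smooth_local_arg R 0 0%N u1 u1h).
have e20 : 0 < e / 2 by rewrite divr_gt0.
move/cvgrPdist_lt/(_ _ e20) : c1 => c1.
move/cvgrPdist_lt/(_ _ e20) : c2 => c2.
have hu : \forall w \near u1, halfplane 0 w.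
  exact: (open_nbhs_nbhs (conj (@open_halfplane R 0) u1h)).
have : \forall u \near u1, exists2 z, cexp z = cplx u & cmod z < e.
  near=> u.
  have h : halfplane 0 u by near: u.
  exists (ln (radius u) +i* local_arg 0 u).
    by rewrite cexpE/= lnK ?posrE ?radius_gt0 ?(halfplane_neq0 h)// -polar_local_arg.
  apply: le_lt_trans (cmod_le _) _; rewrite (splitr e) ltrD//=.
    by rewrite -normrN -sub0r; near: u.
  by rewrite -normrN -sub0r; near: u.
have := @continuous_cart R (1 : R[i]) => cc /cc.
have F1 := nbhs_filter (1 : (R[i])^o).
by apply: (@filterS _ _ F1) => w /= [z]; rewrite cartK => zw ze; exists z.
Unshelve. all: by end_near. Qed.

(** C^x has no small subgroups.  If w and all its iterated squares are within
    1/2 of 1, then |w^2 - 1| = |w + 1| |w - 1| >= 3/2 |w - 1|, so the distance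
    to 1 would grow without bound unless it vanishes. *)
Lemma no_small_subgroup (T : Type) (dbl : T -> T) (f : T -> R[i]) :
  (forall x, f (dbl x) = f x ^+ 2) -> (forall x, cmod (f x - 1) < 2^-1) ->
  forall x, f x = 1.
Proof.
move=> fdbl f1.
have A n (s : T) : (3 / 2) ^+ n * cmod (f s - 1) < 1.
  elim: n s => [|n IH] s.
    by rewrite mul1r (lt_trans (f1 s))// invf_lt1// ltr1n.
  apply: le_lt_trans (IH (dbl s)).
  rewrite fdbl (_ : f s ^+ 2 - 1 = (f s + 1) * (f s - 1)); last by ring.
  rewrite cmodM exprSr -mulrA ler_wpM2l ?exprn_ge0 ?divr_ge0//.
  rewrite ler_wpM2r ?cmod_ge0//.
  have := cmodD (f s + 1) (- (f s - 1)).
  rewrite (_ : _ + _ = (2 : R)%:C); last by rewrite rmorphD rmorph1; ring.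
  rewrite cmodC cmodN ger0_norm//; have := f1 s; lra.
move=> s; apply/eqP; rewrite -subr_eq0; apply/eqP/Normc.eq0_normc.
apply/le_anti; rewrite cmod_ge0 andbT leNgt; apply/negP => e0.
have [n nE] : exists n, (cmod (f s - 1))^-1 < (3 / 2) ^+ n.
  set x := _^-1; have : (GRing.exp (2 / 3 : R)) @ \oo --> (0 : R).
    by apply: cvg_expr; rewrite ger0_norm ?divr_ge0// ltr_pdivrMr// mul1r ltr_nat.
  have x0 : 0 < x by rewrite invr_gt0.
  have xV0 : 0 < x^-1 by rewrite invr_gt0.
  move=> /cvgrPdist_lt/(_ _ xV0)[n _ /(_ n)/=]; rewrite leqnn sub0r normrN.
  move=> /(_ isT); rewrite ger0_norm ?exprn_ge0 ?divr_ge0// => h; exists n.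
  rewrite -[x]invrK invf_plt ?posrE ?exprn_gt0//.
  by rewrite -exprVn invf_div.
have := A n s; rewrite -ltr_pdivlMr// div1r => /ltW/le_lt_trans/(_ nE).
by rewrite ltxx.
Qed.

Lemma character_rho_fun (chi : H -> (R[i])^o) : character R p chi ->
  exists z, chi = rho_fun p z.
Proof.
move=> [chi0 chiD chiC _].
pose o : H := exist _ 0 (mem_set (@Hplus0 R p)).
(* The values of c outside the monoid are never used. *)
pose c (s : R) : R[i] := chi (insubd o s).
have val_o (s : R) : H s -> \val (insubd o s) = s.
  by move=> Hs; rewrite insubdK//; apply/mem_set.
have cD s t : H s -> H t -> c (s + t) = c s * c t.
  by move=> Hs Ht; apply: chiD; rewrite !val_o//; exact: HplusD.
have c0 : c 0 = 1 by apply: chi0; rewrite val_o//; exact: Hplus0.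
have near_chi (P : set R[i]) : nbhs (1 : (R[i])^o) P ->
    exists2 d : R, 0 < d & forall s, H s -> s < d -> P (c s).
  rewrite -(chi0 o erefl) => /chiC /nbhs_initialP[B].
  rewrite /= -nbhs_ballE => -[d /= d0 dB BP]; exists d => // s Hs sd.
  apply: BP => /=; apply: dB.
  change (`|0 - \val (insubd o s)| < d).
  rewrite val_o// sub0r normrN ger0_norm//; exact: Hs.1.
(* If a and b are within 1/8 of 1, then a b is within 1/2 of 1, since
   a b - 1 = (a - 1) (b - 1) + (a - 1) + (b - 1). *)
have e8 : 0 < 8^-1 :> R by rewrite invr_gt0.
have [e1 e10 He1] : exists2 e : R, 0 < e &
    forall z, cmod z < e -> cmod (cexp z - 1) < 8^-1.
  have ce := @continuous_cexp R (0 : R[i]).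
  have := near_cmod (cexp (0 : R[i])) e8 => /ce /nbhs_cmodP[e e0 He].
  exists e => // w we.
  by rewrite -cmodN opprB -cexp0; apply: He; rewrite sub0r cmodN.
have [d1 d10 Hd1] := near_chi _ (cexp_near1 e10).
have [d2 d20 Hd2] := near_chi _ (near_cmod 1 e8).
have d0 : 0 < Num.min d1 d2 by rewrite lt_min d10.
have [N] := Hplus_small hp d0; rewrite lt_min => /andP[N1 N2].
set t0 := _^-1 in N1 N2; have t00 : 0 < t0 by rewrite invr_gt0 (pX_gt0 hp).
have Ht0 : H t0 by exact: HplusV.
have [z0 z0E z0e] := Hd1 _ Ht0 N1.
pose z := z0 / t0%:C.
pose f (s : H) := c (\val s) * cexp (- (z * (\val s)%:C)).
have HH (s : H) : H (\val s) by case: s => s /= /set_mem.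
have fD (r s t : H) : \val r = \val s + \val t -> f r = f s * f t.
  move=> e; rewrite /f e cD; [|exact: HH..].
  by rewrite rmorphD mulrDr opprD cexpD mulrACA.
pose T0 : H := exist _ t0 (mem_set Ht0).
have fT0 : f T0 = 1.
  rewrite /f/= -z0E /z divfK; last first.
    by rewrite -(rmorph0 (real_complex R)) (inj_eq (@complexI _)) gt_eqF.
  by rewrite -cexpD subrr cexp0.
(* For s <= t0, both chi s and exp (- z s) are close to 1, as |z s| <= |z0|. *)
have fsmall (s : H) : \val s <= t0 -> cmod (f s - 1) < 2^-1.
  move=> st.
  have s0 : 0 <= \val s := (HH s).1.
  have A1 : cmod (c (\val s) - 1) < 8^-1.
    by rewrite -cmodN opprB; apply: Hd2 (HH s) _; apply: le_lt_trans N2.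
  have A2 : cmod (cexp (- (z * (\val s)%:C)) - 1) < 8^-1.
    apply: He1; rewrite cmodN /z -mulrA -fmorphV -rmorphM cmodM cmodC.
    apply: le_lt_trans z0e; rewrite ler_piMr ?cmod_ge0//.
    have t0V : 0 <= t0^-1 by rewrite invr_ge0 ltW.
    by rewrite ger0_norm ?mulr_ge0// mulrC ler_pdivrMr// mul1r.
  rewrite /f; set a := c _ in A1 *; set b := cexp _ in A2 *.
  rewrite (_ : a * b - 1 = (a - 1) * (b - 1) + ((a - 1) + (b - 1))); last by ring.
  apply: le_lt_trans (cmodD _ _) _; rewrite cmodM.
  have := cmodD (a - 1) (b - 1).
  have := cmod_ge0 (a - 1); have := cmod_ge0 (b - 1).
  nra.
have fT0n (n : nat) (s : H) : \val s = t0 *+ n -> f s = 1.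
  elim: n s => [|n IH] s e.
    by rewrite /f e mulr0n c0 mulr0 oppr0 cexp0 mulr1.
  have HtN := HplusMn hp n Ht0.
  pose T1 : H := exist _ (t0 *+ n) (mem_set HtN).
  rewrite (fD s T0 T1); last by rewrite e mulrS.
  by rewrite fT0 mul1r IH.
(* By periodicity, the bound on [0, t0] holds everywhere. *)
have f1 (s : H) : cmod (f s - 1) < 2^-1.
  have s0 : 0 <= \val s := (HH s).1.
  pose k := Num.trunc (\val s / t0).
  have st0 : 0 <= \val s / t0 by rewrite divr_ge0// ltW.
  have k1 : t0 *+ k <= \val s.
    by rewrite -mulr_natl -ler_pdivlMr// truncn_le.
  have k2 : \val s < t0 *+ k.+1.
    by rewrite -mulr_natl -ltr_pdivrMr// truncnS_gt.
  have HtN := HplusMn hp k Ht0.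
  have HtB := HplusB hp (HH s) HtN k1.
  pose T1 : H := exist _ (t0 *+ k) (mem_set HtN).
  pose T2 : H := exist _ (\val s - t0 *+ k) (mem_set HtB).
  rewrite (fD s T1 T2); last first.
    by rewrite /= addrC subrK.
  rewrite (fT0n k)// mul1r; apply: fsmall => /=.
  by rewrite lerBlDr -mulrS ltW.
exists z; apply/funext => s.
have : f s = 1.
  have dbl (r : H) : f (insubd o (\val r + \val r)) = f r ^+ 2.
    by rewrite (fD _ r r) ?expr2// val_o//; apply: HplusD.
  exact: no_small_subgroup dbl f1 s.
rewrite /f /c valKd => e.
by rewrite /rho_fun -[LHS]mulr1 -(@cexp0 R) -(addNr (z * (\val s)%:C)) cexpD mulrA
  e mul1r.
Qed.

End classification.

(** * The three quotient spaces *)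

Section quotients.
Local Open Scope quotient_scope.
Context {R : realType} (p : nat) (hp : prime p).
Implicit Types (z w : R[i]) (s t : R) (u v : R * R) (r : Minf R p).

Lemma val_rho z : z != 0 -> \val (rho p z : character R p) = rho_fun p z.
Proof. by move=> z0; rewrite val_insubd (mem_set (rho_fun_character hp z0)). Qed.

(** Existence and uniqueness of z make the choice in [zcoord] a genuine
    inverse of [rho]. *)
Lemma rho_fun_zcoord (c : character R p) : \val c = rho_fun p (zcoord c).
Proof.
have [|z zE] := @character_rho_fun R p hp (\val c).
  by case: c => c /= /set_mem.
exact: (xgetPex 0 (ex_intro (fun z => \val c = rho_fun p z) z zE)).
Qed.

Lemma zcoord_neq0 r : zcoord (r : character R p) != 0.
Proof.
apply/negP => /eqP r0; have /set_mem[_ _ _ [t]] := valP (r : character R p).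
by rewrite rho_fun_zcoord r0 /rho_fun mul0r cexp0 eqxx.
Qed.

Lemma zcoord_rho z : z != 0 -> zcoord (rho p z : character R p) = z.
Proof. by move=> z0; apply: (rho_fun_inj hp); rewrite -rho_fun_zcoord val_rho. Qed.

Lemma rho_zcoord r : rho p (zcoord (r : character R p)) = r.
Proof. by apply: val_inj; rewrite val_rho ?zcoord_neq0// -rho_fun_zcoord. Qed.

Lemma rho_bij : set_bij [set z : R[i] | z != 0] setT (@rho R p).
Proof.
split=> // [z w /set_mem z0 /set_mem w0 zw|r _].
  by rewrite -(zcoord_rho z0) zw zcoord_rho.
by exists (zcoord (r : character R p)); [exact: zcoord_neq0|exact: rho_zcoord].
Qed.

Lemma pXzC (n : int) : (p%:R ^ n : R[i]) = (p%:R ^ n)%:C.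
Proof. by rewrite -(rmorph_nat (real_complex R)) fmorphXz. Qed.

Lemma pXz_gt0 (n : int) : 0 < p%:R ^ n :> R.
Proof. by rewrite exprz_gt0// (lt_trans _ (@p_gt1 R p hp)). Qed.

Lemma posreal_complex z : 0 < z -> exists2 a : R, 0 < a & z = a%:C.
Proof.
move=> z0; have /complex_realP[a aE] : z \is Num.real by rewrite gtr0_real.
by exists a => //; rewrite aE ltcR in z0.
Qed.

Lemma to_E_eq r r' : to_E hp r = to_E hp r' <->
  exists n : int, zcoord (r' : character R p) =
    p%:R ^ n * zcoord (r : character R p).
Proof.
split=> [/eqmodP/asboolP[_ [n _ <-] ->]|[n E]]; first by exists n.
by apply/eqmodP/asboolP; exists (p%:R ^ n) => //; exists n.
Qed.

Lemma to_E_rho_eq z w : z != 0 -> w != 0 ->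
  to_E hp (rho p z) = to_E hp (rho p w) <-> exists n : int, w = p%:R ^ n * z.
Proof. by move=> z0 w0; rewrite to_E_eq !zcoord_rho. Qed.

(** The ambiguity of the parametrization of the curve; similarly for the two
    factors in [coordsX_eq] and [coordsC_eq]. *)
Lemma coordsE_eq u v : u != 0 -> v != 0 ->
  coordsE R hp u = coordsE R hp v <-> exists n : int, v = p%:R ^ n *: u.
Proof.
move=> u0 v0; rewrite /= to_E_rho_eq ?cplx_eq0//; split=> -[n E]; exists n.
  by apply: (can_inj (@cplxK R)); rewrite E pXzC; case: (u) => x y; simpc.
by rewrite E pXzC; case: (u) => x y; simpc.
Qed.

Lemma to_X_eq r r' : to_X r = to_X r' <->
  exists2 a : R, 0 < a & zcoord (r' : character R p) =
    a%:C * zcoord (r : character R p).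
Proof.
split=> [/eqmodP/asboolP[_ /posreal_complex[a a0 ->] ->]|[a a0 E]].
  by exists a.
by apply/eqmodP/asboolP; exists a%:C => //; rewrite /posreals/= ltcR.
Qed.

Lemma to_X_rho_eq z w : z != 0 -> w != 0 ->
  to_X (rho p z) = to_X (rho p w) <-> exists2 a : R, 0 < a & w = a%:C * z.
Proof. by move=> z0 w0; rewrite to_X_eq !zcoord_rho. Qed.

Lemma coordsX_eq s t :
  coordsX R p s = coordsX R p t <-> exists k : int, t = s + 2 * pi * k%:~R.
Proof.
rewrite /= !cexp_imag to_X_rho_eq ?cis_neq0// -cis_eq; split=> [[a a0 E]|->].
  rewrite E; have := congr1 (@cmod R) E.
  rewrite cmodM !cmod_cis cmodC mulr1 gtr0_norm// => <-.
  by rewrite rmorph1 mul1r.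
by exists 1 => //; rewrite rmorph1 mul1r.
Qed.

Lemma val_to_Rpos s : 0 < s -> \val (to_Rpos s) = s.
Proof. by move=> s0; rewrite val_insubd (mem_set (s0 : posreals s)). Qed.

Lemma coordsC_eq s t : 0 < s -> 0 < t ->
  coordsC R hp s = coordsC R hp t <-> exists n : int, t = p%:R ^ n * s.
Proof.
move=> s0 t0; split=> [/eqmodP/asboolP[_ [n _ <-]]|[n E]].
  by rewrite !val_to_Rpos//; exists n.
apply/eqmodP/asboolP; exists (p%:R ^ n); first by exists n.
by rewrite !val_to_Rpos.
Qed.

Lemma coordsE_surj (e : Ecurve R hp) : exists2 u, u != 0 & e = coordsE R hp u.
Proof.
elim/quotW: e => r; exists (cart (zcoord (r : character R p))).
  by rewrite -cplx_eq0 cartK zcoord_neq0.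
by rewrite /= cartK rho_zcoord.
Qed.

Lemma coordsX_surj (x : Xtilde R p) : exists t, x = coordsX R p t.
Proof.
elim/quotW: x => r; have [t tE] := polar (zcoord (r : character R p)).
have r0 := zcoord_neq0 r; exists t.
rewrite /= -(rho_zcoord r) cexp_imag.
apply/esym/to_X_rho_eq => //; first exact: cis_neq0.
by exists (cmod (zcoord (r : character R p))) => //; rewrite cmod_gt0.
Qed.

Lemma coordsC_surj (x : Cp R hp) : exists2 s, 0 < s & x = coordsC R hp s.
Proof.
elim/quotW: x => -[s s0]; exists s; first exact: set_mem s0.
rewrite /= /to_C; congr (\pi _); apply: val_inj.
by rewrite /= val_to_Rpos//; exact: set_mem s0.
Qed.

(** Powers of p are discrete in the positive reals; as p >= 2, the interval
    (1/2, 2) serves for all primes. *)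
Lemma pXz_near1 (n : int) : 2^-1 < p%:R ^ n :> R -> p%:R ^ n < 2 :> R -> n = 0.
Proof.
have p2 : 2 <= p%:R :> R by rewrite ler_nat prime_gt1.
have aux (m : nat) : p%:R ^+ m < 2 :> R -> m = 0%N.
  case: m => // m; rewrite exprS => h; exfalso; move: h; apply/negP.
  by rewrite -leNgt (le_trans p2)// ler_peMr// ?exprn_ege1 ?(le_trans _ p2)// ler1n.
case: n => n /=; first by move=> _ /aux ->.
by rewrite NegzE -exprnN ltf_pV2 ?posrE ?exprn_gt0 ?(lt_le_trans _ p2)// => /aux.
Qed.

End quotients.

(** * Rigidity of lifts *)

Section rigidity.
Context {R : realType} (p : nat) (hp : prime p).
Implicit Types (s t : R) (u v : R * R) (r : Minf R p).

(** A continuous function with values in a discrete set is locally constant. *)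
Lemma pXz_locally_constant (T : topologicalType) (x : T) (g : T -> R) :
  {for x, continuous g} -> (\forall w \near x, exists n : int, g w = p%:R ^ n) ->
  exists n : int, \forall w \near x, g w = p%:R ^ n.
Proof.
move=> gx gn; have [n gxn] := nbhs_singleton gn; exists n.
have g0 : 0 < g x by rewrite gxn pXz_gt0.
have lo : \forall w \near x, g x / 2 < g w.
  by apply: (cvgr_gt (g x)) => //; rewrite ltr_pdivrMr// ltr_pMr// ltr1n.
have hi : \forall w \near x, g w < g x * 2.
  by apply: (cvgr_lt (g x)) => //; rewrite ltr_pMr// ltr1n.
near=> w.
have [m gwm] : exists m : int, g w = p%:R ^ m by near: w.
have lo' : g x / 2 < g w by near: w.
have hi' : g w < g x * 2 by near: w.
rewrite gxn gwm in lo' hi'.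
have pn0 := @pXz_gt0 R p hp n.
have mn : p%:R ^ (m - n) = p%:R ^ m / p%:R ^ n :> R.
  by rewrite expfzDr ?pnz// -invr_expz.
have /eqP : m - n = 0.
  apply: (@pXz_near1 R p hp); rewrite mn.
    by rewrite ltr_pdivlMr// [_^-1 * _]mulrC.
  by rewrite ltr_pdivrMr// [2 * _]mulrC.
by rewrite subr_eq0 => /eqP <-.
Unshelve. all: by end_near. Qed.

Lemma radiusZ (a : R) u : radius (a *: u) = `|a| * radius u.
Proof.
rewrite /radius (_ : sqnorm _ = a ^+ 2 * sqnorm u).
  by rewrite sqrtrM ?sqr_ge0// sqrtr_sqr.
by rewrite /sqnorm /= -![_ *: _]/(_ * _); ring.
Qed.

Lemma continuous_radius u : u != 0 -> {for u, continuous (@radius R)}.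
Proof. exact: (@smooth_radius R 0%N u). Qed.

Lemma near_neq0 (T : topologicalType) (x : T) (f : T -> R * R) :
  {for x, continuous f} -> f x != 0 -> \forall w \near x, f w != 0.
Proof.
move=> cf f0; apply: (cf [set u | u != 0]).
exact: (open_nbhs_nbhs (conj (@open_neq0 R) f0)).
Qed.

(** Two lifts differ by a power of p at each point, whose exponent is read off
    from the quotient of the radii, a continuous function. *)
Lemma coordsE_rigid (T : topologicalType) (x : T) (phi f : T -> R * R) :
  {for x, continuous phi} -> {for x, continuous f} -> phi x != 0 -> f x != 0 ->
  (\forall w \near x, coordsE R hp (phi w) = coordsE R hp (f w)) ->
  exists n : int, \forall w \near x, phi w = p%:R ^ n *: f w.
Proof.
move=> cphi cf phi0 f0 E.
have Phi0 := near_neq0 cphi phi0; have F0 := near_neq0 cf f0.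
pose g w := radius (phi w) / radius (f w).
have [||n gn] := @pXz_locally_constant T x g.
- apply: cvgM; first by apply: continuous_comp => //; exact: continuous_radius.
  apply: cvgV; first by rewrite gt_eqF ?radius_gt0.
  by apply: continuous_comp => //; exact: continuous_radius.
- apply: filterS3 E Phi0 F0 => w /esym Ew p0 w0.
  have [m mE] := (coordsE_eq hp w0 p0).1 Ew; exists m.
  by rewrite /g mE radiusZ gtr0_norm ?pXz_gt0// mulfK// gt_eqF ?radius_gt0.
exists n; near=> w.
have w0 : f w != 0 by near: w.
have Ew : coordsE R hp (f w) = coordsE R hp (phi w) by apply/esym; near: w.
have p0 : phi w != 0 by near: w.
have [m mE] := (coordsE_eq hp w0 p0).1 Ew.
have : g w = p%:R ^ n by near: w.
by rewrite /g mE radiusZ gtr0_norm ?pXz_gt0// mulfK ?gt_eqF ?radius_gt0// => ->.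
Unshelve. all: by end_near. Qed.

Lemma coordsC_rigid (T : topologicalType) (x : T) (phi f : T -> R) :
  {for x, continuous phi} -> {for x, continuous f} -> 0 < phi x -> 0 < f x ->
  (\forall w \near x, coordsC R hp (phi w) = coordsC R hp (f w)) ->
  exists n : int, \forall w \near x, phi w = p%:R ^ n * f w.
Proof.
move=> cphi cf phi0 f0 E.
have Phi0 : \forall w \near x, 0 < phi w by exact: (cvgr_gt (phi x)).
have F0 : \forall w \near x, 0 < f w by exact: (cvgr_gt (f x)).
pose g w := phi w / f w.
have [||n gn] := @pXz_locally_constant T x g.
- by apply: cvgM => //; apply: cvgV => //; rewrite gt_eqF.
- apply: filterS3 E Phi0 F0 => w /esym Ew p0 w0.
  have [m mE] := (coordsC_eq hp w0 p0).1 Ew; exists m.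
  by rewrite /g mE mulfK// gt_eqF.
exists n; near=> w.
have w0 : 0 < f w by near: w.
have <- : g w = p%:R ^ n by near: w.
by rewrite divfK// gt_eqF.
Unshelve. all: by end_near. Qed.

(** The difference of two lifts is continuous with values in 2 pi Z. *)
Lemma coordsX_rigid (T : topologicalType) (x : T) (phi f : T -> R) :
  {for x, continuous phi} -> {for x, continuous f} ->
  (\forall w \near x, coordsX R p (phi w) = coordsX R p (f w)) ->
  exists k : int, \forall w \near x, phi w = f w + 2 * pi * k%:~R.
Proof.
move=> cphi cf E.
have pp : 0 < 2 * pi :> R by rewrite mulr_gt0// pi_gt0.
have E' : \forall w \near x, exists k : int, phi w = f w + 2 * pi * k%:~R.
  apply: filterS E => w /esym Ew.
  by have [k kE] := (@coordsX_eq R p hp _ _).1 Ew; exists k.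
have [k kE] := nbhs_singleton E'; exists k.
have cd : (phi w - f w) @[w --> x] --> phi x - f x by apply: cvgB.
move/cvgrPdist_lt/(_ _ pp) : cd => D.
near=> w.
have [m mE] : exists k : int, phi w = f w + 2 * pi * k%:~R by near: w.
have km : `|(k - m)%:~R : R| < 1.
  have : `|phi x - f x - (phi w - f w)| < 2 * pi by near: w.
  rewrite kE mE [f x + _]addrC [f w + _]addrC !addrK -mulrBr normrM gtr0_norm//.
  by rewrite gtr_pMr// -intrB.
rewrite -intr_norm -[1]/(1%:~R) ltr_int in km.
by rewrite mE; have -> : m = k by lia.
Unshelve. all: by end_near. Qed.

End rigidity.

(** * The coordinates are etale *)

Section etale_coordinates.
Local Open Scope quotient_scope.
Context {R : realType} (p : nat) (hp : prime p).
Implicit Types (s t : R) (u v : R * R) (r : Minf R p).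

Lemma rho_continuous (z : R[i]) : z != 0 ->
  {for z, continuous (@rho R p : (R[i])^o -> Minf R p)}.
Proof.
move=> z0 A /nbhs_initialP[B]; rewrite zcoord_rho// => zB BA.
have F := nbhs_filter (z : (R[i])^o).
have nz : nbhs (z : (R[i])^o) [set w | w != 0].
  have := near_cmod z; rewrite -cmod_gt0 in z0; move=> /(_ _ z0).
  apply: (@filterS _ _ F) => w; apply: contraPneq => ->.
  by rewrite subr0 ltxx.
apply: (@filterS2 _ _ F _ _ _ _ nz zB) => w w0 Bw; apply: BA.
by rewrite /= zcoord_rho.
Qed.

(** Openness: the points of the curve near that of u are the images of the
    characters z with p^n z near u.  Local injectivity: on the annulus
    2/3 |u| < |w| < 4/3 |u| the quotient of two radii lies in (1/2, 2). *)
Lemma coordsE_etale : etale (coordsE R hp).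
Proof.
split.
- exact: open_neq0.
- apply/seteqP; split => // e _; have [u u0 ->] := coordsE_surj e.
  by exists u.
- move=> u u0; apply: (@continuous_comp _ _ _ (fun u => rho p (cplx u)) (to_E hp)).
    have cu0 : cplx u != 0 by rewrite cplx_eq0.
    exact: (continuous_comp (@continuous_cplx R u) (rho_continuous cu0)).
  exact: pi_continuous.
- move=> U oU U0; apply: (_ : open (to_E hp @^-1` _)); rewrite openE => r.
  move=> [u Uu] /= /esym/to_E_eq[n]; rewrite (zcoord_rho hp) ?cplx_eq0; last exact: U0.
  move=> uE; apply/nbhs_initialP.
  exists [set z | U (cart (p%:R ^ n * z))].
    have c : {for zcoord (r : character R p) : (R[i])^o, continuous
        (fun z : (R[i])^o => cart (p%:R ^ n * z))}.
      apply: continuous_comp; last exact: continuous_cart.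
      by apply: (@mulrl_continuous R[i]).
    apply: c; rewrite -uE cplxK; exact: (open_nbhs_nbhs (conj oU Uu)).
  move=> r' /= Ur'; exists (cart (p%:R ^ n * zcoord (r' : character R p))) => //.
  apply/esym/to_E_eq; exists n; rewrite cartK zcoord_rho// mulf_neq0//.
    by rewrite expfz_neq0 ?pnz.
  exact: (zcoord_neq0 hp).
- move=> u u0; have r0 : 0 < radius u by rewrite radius_gt0.
  pose U := [set w | 2 / 3 * radius u < radius w < 4 / 3 * radius u].
  have RU w : U w -> w != 0.
    by rewrite /U/= -radius_gt0 => /andP[+ _]; apply: lt_trans; rewrite mulr_gt0.
  exists U.
    have c := continuous_radius u0.
    near=> w; apply/andP; split.
      near: w; apply: (cvgr_gt (radius u)) => //.
      by rewrite gtr_pMl// ltr_pdivrMr// mul1r ltr_nat.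
    near: w; apply: (cvgr_lt (radius u)) => //.
    by rewrite ltr_pMl// ltr_pdivlMr// mul1r ltr_nat.
  move=> v w /set_mem Uv /set_mem Uw /(coordsE_eq hp (RU v Uv) (RU w Uw))[n nE].
  move: Uv Uw; rewrite /U/= nE radiusZ gtr0_norm ?pXz_gt0//.
  set q := p%:R ^ n; set a := radius v; set b := radius u in r0 * => /andP[v1 v2].
  move=> /andP[w1 w2].
  have a0 : 0 < a by apply: lt_trans v1; rewrite mulr_gt0.
  rewrite /q; have -> : n = 0.
    by apply: (@pXz_near1 R p hp); rewrite -/q; nra.
  by rewrite expr0z scale1r.
Unshelve. all: by end_near. Qed.

(** Openness: the branch of the argument near a nonzero z provides a
    continuous local section of the quotient by the positive reals. *)
Lemma coordsX_etale : etale (coordsX R p).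
Proof.
split.
- exact: openT.
- apply/seteqP; split => // e _; have [t ->] := coordsX_surj hp e.
  by exists t.
- move=> t _; apply: (@continuous_comp _ _ _ (fun t => rho p (cexp (0 +i* t)))
    (@to_X R p)); last exact: pi_continuous.
  have -> : (fun t : R => rho p (cexp (0 +i* t))) = @rho R p \o (@cis R).
    by apply/funext => s; rewrite /= cexp_imag.
  exact: (continuous_comp (@continuous_cis R t) (rho_continuous (cis_neq0 t))).
- move=> U oU _; apply: (_ : open (@to_X R p @^-1` _)); rewrite openE => r.
  move=> [t Ut] /=; rewrite cexp_imag => /esym/to_X_eq[a a0].
  rewrite (zcoord_rho hp) ?cis_neq0// => tE; apply/nbhs_initialP.
  set z := zcoord _ in tE *; have z0 : z != 0 := zcoord_neq0 hp r.
  have [h ht] : halfplane t (cart z) /\ local_arg t (cart z) = t.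
    apply: halfplane_polar; first by rewrite -cplx_eq0 cartK.
    rewrite cartK -cmod_cplx cartK tE mulrA -rmorphM.
    have := congr1 (@cmod R) tE; rewrite cmod_cis cmodM cmodC gtr0_norm// mulrC.
    by move=> <-; rewrite rmorph1 mul1r.
  exists [set z | halfplane t (cart z) /\ U (local_arg t (cart z))].
    apply: (@continuous_cart R z [set u | halfplane t u /\ U (local_arg t u)]).
    apply: filterI; first exact: (open_nbhs_nbhs (conj (@open_halfplane R t) h)).
    apply: (@smooth_local_arg R t 0%N _ h); rewrite ht.
    exact: (open_nbhs_nbhs (conj oU Ut)).
  move=> r' /= [h' U']; exists (local_arg t (cart (zcoord (r' : character R p)))) => //.
  rewrite cexp_imag; apply/to_X_eq.
  exists (radius (cart (zcoord (r' : character R p)))).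
    by rewrite radius_gt0; exact: halfplane_neq0 h'.
  by rewrite (zcoord_rho hp) ?cis_neq0// -polar_local_arg// cartK.
- move=> t _; exists [set s | `|t - s| < 1].
    by apply: (@nbhsx_ballx _ _ t 1).
  have tp : 2 < 2 * pi :> R by rewrite ltr_pMr// (lt_le_trans _ (pi_ge2 R))// ltr1n.
  move=> s s' /set_mem/= s1 /set_mem/= s2 /(coordsX_eq hp)[k kE].
  have k1 : `|2 * pi * k%:~R : R| < 2 * pi.
    apply: lt_trans tp; rewrite (_ : _ * _ = (t - s) - (t - s')).
      by rewrite (le_lt_trans (ler_normB _ _))// -[2]/(1 + 1) ltrD.
    by rewrite kE; ring.
  have tp0 : 0 < 2 * pi :> R by apply: lt_trans tp.
  rewrite normrM (gtr0_norm tp0) gtr_pMr// in k1.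
  rewrite -intr_norm -[1]/(1%:~R) ltr_int in k1.
  have k0 : k = 0 by lia.
  by rewrite kE k0 mulr0 addr0.
Qed.

Lemma coordsC_etale : etale (coordsC R hp).
Proof.
split.
- exact: open_gt.
- apply/seteqP; split => // e _; have [s s0 ->] := coordsC_surj e.
  by exists s.
- move=> s s0; apply: (@continuous_comp _ _ _ (@to_Rpos R)
    (\pi_{eq_quot (Cp_equiv R hp)} : Rpos R -> Cp R hp)); last exact: pi_continuous.
  move=> A /nbhs_initialP[B sB BA].
  have {}sB : nbhs s B by rewrite -(val_to_Rpos s0).
  have pos : \forall t \near s, 0 < t.
    exact: (open_nbhs_nbhs (conj (@open_gt R 0) s0)).
  apply: filterS2 pos sB => t t0 Bt; apply: BA.
  by rewrite -(val_to_Rpos t0) in Bt.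
- move=> U oU U0.
  apply: (_ : open ((\pi_{eq_quot (Cp_equiv R hp)} : Rpos R -> Cp R hp) @^-1` _)).
  rewrite openE => x [s Us] /= xE.
  have x0 : 0 < \val x := set_mem (valP x).
  have toK : to_Rpos (\val x) = x by apply: val_inj; rewrite val_to_Rpos.
  have {xE}xE : coordsC R hp (\val x) = coordsC R hp s.
    by rewrite /= xE /to_C toK.
  have [n nE] := (coordsC_eq hp x0 (U0 _ Us)).1 xE.
  have pn := @pXz_gt0 R p hp n.
  apply/nbhs_initialP; exists [set t | U (p%:R ^ n * t)].
    have c : {for \val x, continuous (fun t : R => p%:R ^ n * t)}.
      by apply: (@mulrl_continuous R).
    by apply: c; rewrite -nE; exact: (open_nbhs_nbhs (conj oU Us)).
  move=> y Uy; exists (p%:R ^ n * \val y) => //.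
  have y0 : 0 < \val y := set_mem (valP y).
  have tyK : to_Rpos (\val y) = y by apply: val_inj; rewrite val_to_Rpos.
  rewrite -[in RHS]tyK; apply/esym; apply/(coordsC_eq hp y0); last by exists n.
  exact: mulr_gt0.
- move=> s s0; exists [set t | 2 / 3 * s < t < 4 / 3 * s].
    have lo : 2 / 3 * s < s by rewrite gtr_pMl// ltr_pdivrMr// mul1r ltr_nat.
    have hi : s < 4 / 3 * s by rewrite ltr_pMl// ltr_pdivlMr// mul1r ltr_nat.
    near=> t; apply/andP; split; near: t.
      exact: (open_nbhs_nbhs (conj (@open_gt R _) lo)).
    exact: (open_nbhs_nbhs (conj (@open_lt R _) hi)).
  move=> v w /set_mem/= /andP[v1 v2] /set_mem/= /andP[w1 w2].
  have b0 : 0 < 2 / 3 * s by rewrite mulr_gt0.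
  have v0 : 0 < v by apply: lt_trans v1.
  have w0 : 0 < w by apply: lt_trans w1.
  move=> /(coordsC_eq hp v0 w0)[n nE].
  rewrite nE in w1 w2 *; have -> : n = 0.
    by apply: (@pXz_near1 R p hp); move: (p%:R ^ n) w1 w2 => q w1 w2; nra.
  by rewrite expr0z mul1r.
Unshelve. all: by end_near. Qed.

End etale_coordinates.

Section manifold_maps.
Context {R : realType}.

Lemma prod_coords_continuous (V W : normedModType R) (X Y : topologicalType)
    (c : coords V X) (d : coords W Y) : etale c -> etale d ->
  forall u, cdom (prod_coords c d) u ->
    {for u, continuous (prod_coords c d : V * W -> X * Y)}.
Proof.
move=> [_ _ cc _ _] [_ _ dc _ _] [u v] [/= cu dv].
have A : {for (u, v), continuous (fun w : V * W => c w.1)}.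
  by apply: (@continuous_comp _ _ _ fst c); [exact: cvg_fst|exact: cc].
have B : {for (u, v), continuous (fun w : V * W => d w.2)}.
  by apply: (@continuous_comp _ _ _ snd d); [exact: cvg_snd|exact: dc].
exact: (cvg_pair A B).
Qed.

(** Continuity can be checked after composing with a surjective open map, and
    there it follows from the continuity of the local expressions. *)
Lemma smooth_map_continuous (V W : normedModType R) (X Y : topologicalType)
    (c : coords V X) (d : coords W Y) (f : X -> Y) :
  (c @` cdom c = setT) ->
  (forall U, open U -> U `<=` cdom c -> open (c @` U)) -> open (cdom c) ->
  (forall u, cdom d u -> {for u, continuous (d : W -> Y)}) ->
  smooth_map c d f -> continuous f.
Proof.
move=> csurj copen cd dc sf x.
have [u cu <-] : (c @` cdom c) x by rewrite csurj.
have [phi [/smooth_near_continuous cphi dphi E]] := sf u cu.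
move=> A; rewrite -(nbhs_singleton E) => /(dc _ dphi)/cphi nA.
have {}nA : \forall w \near u, A (d (phi w)) by exact: nA.
have : nbhs u [set w | cdom c w /\ A (f (c w))].
  have nc := open_nbhs_nbhs (conj cd cu).
  near=> w; split; first by near: w.
  have <- : d (phi w) = f (c w) by near: w.
  by near: w.
rewrite nbhsE => -[U [oU Uu] UA].
have oc : open (c @` U) by apply: copen => // w /UA[].
have ncu : open_nbhs (c u) (c @` U) by split => //; exists u.
by apply: filterS (open_nbhs_nbhs ncu) => _ [w /UA[_ Aw] <-].
Unshelve. all: by end_near. Qed.

End manifold_maps.

(** * Manifold structures and the decomposition *)

Section smooth_structures.
Context {R : realType} (p : nat) (hp : prime p).
Implicit Types (s t : R) (u v : R * R) (r : Minf R p).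
Local Notation cE := (coordsE R hp).
Local Notation cC := (coordsC R hp).
Local Notation cX := (coordsX R p).

Lemma transitionE u phi : transition cE u phi ->
  exists n : int, \forall w \near u, phi w = p%:R ^ n *: w.
Proof.
move=> [u0 phi0 cphi E]; apply: (coordsE_rigid (f := id)) E => //.
exact: nbhs_singleton cphi.
Qed.

Lemma transitionC s phi : transition cC s phi ->
  exists n : int, \forall w \near s, phi w = p%:R ^ n *: w.
Proof.
move=> [s0 phi0 cphi E]; apply: (coordsC_rigid (f := id)) E => //.
exact: nbhs_singleton cphi.
Qed.

Lemma transitionX s phi : transition cX s phi ->
  exists k : int, \forall w \near s, phi w = w + 2 * pi * k%:~R.
Proof.
move=> [_ _ cphi E]; apply: (coordsX_rigid hp (f := id)) E => //.
exact: nbhs_singleton cphi.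
Qed.

Lemma smooth_manifoldE : smooth_manifold cE.
Proof.
split; first exact: coordsE_etale.
move=> u phi /transitionE[n /smooth_near_ext]; apply.
exact: smooth_near_scale.
Qed.

Lemma smooth_manifoldC : smooth_manifold cC.
Proof.
split; first exact: coordsC_etale.
move=> u phi /transitionC[n /smooth_near_ext]; apply.
exact: (@smooth_near_scale R^o).
Qed.

Lemma smooth_manifoldX : smooth_manifold cX.
Proof.
split; first exact: coordsX_etale.
move=> u phi /transitionX[k /smooth_near_ext]; apply.
exact: smooth_near_translate.
Qed.

Lemma complex_derivable_scale (a z : R[i]) :
  @derivable R[i] (R[i])^o (R[i])^o (fun w => a * w) z 1.
Proof. exact: (@derivableZ R[i] (R[i])^o (R[i])^o id a z 1). Qed.

Lemma riemann_surfaceE : riemann_surface cE.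
Proof.
split; first exact: coordsE_etale.
move=> u phi /transitionE[n nE].
have [U [oU Uu] UE] : exists2 U, open_nbhs u U &
    U `<=` [set w | phi w = p%:R ^ n *: w].
  by move: nE; rewrite /prop_near1 nbhsE.
have nU := open_nbhs_nbhs (conj oU Uu).
have {}nU : \forall w \near u, U w := nU.
near=> w; have Uw : U w by near: w.
move=> _ ->.
have F := nbhs_filter (cplx w : (R[i])^o).
have N : \forall z \near (cplx w : (R[i])^o),
    (cplx \o phi \o cart) z = p%:R ^ n * z.
  have : nbhs (cart (cplx w)) U.
    by rewrite cplxK; exact: (open_nbhs_nbhs (conj oU Uw)).
  move=> /(@continuous_cart R (cplx w)).
  apply: (@filterS _ _ F) => z /= Uz.
  by rewrite (UE _ Uz) pXzC; case: (z) => x y; rewrite /cart /cplx/=; simpc.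
have N' : \forall z \near (cplx w : (R[i])^o),
    p%:R ^ n * z = (cplx \o phi \o cart) z.
  by apply: (@filterS _ _ F) N => z ->.
apply: (@near_eq_derivable R[i] (R[i])^o (R[i])^o _ _ _ 1 N').
exact: complex_derivable_scale.
Unshelve. all: by end_near. Qed.

Lemma decomposition_rho (z : R[i]) : z != 0 ->
  decomposition hp (to_E hp (rho p z)) = (to_C hp (cmod z), to_X (rho p z)).
Proof.
move=> z0; rewrite /decomposition.
set r := repr _.
have : to_E hp r = to_E hp (rho p z) by rewrite /to_E reprK.
move=> /to_E_eq[n]; rewrite (zcoord_rho hp)// => zE.
have r0 := zcoord_neq0 hp r.
congr pair.
  apply/(coordsC_eq hp); rewrite ?cmod_gt0//; exists n.
  by rewrite zE cmodM pXzC cmodC gtr0_norm// pXz_gt0.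
apply/to_X_eq; exists (p%:R ^ n); first exact: pXz_gt0.
by rewrite (zcoord_rho hp)// zE pXzC.
Qed.

Lemma decomposition_coords u t : u != 0 -> cplx u = (radius u)%:C * cis t ->
  decomposition hp (cE u) = (cC (radius u), cX t).
Proof.
move=> u0 ut; rewrite /= decomposition_rho ?cplx_eq0// cmod_cplx.
congr pair; rewrite cexp_imag; apply/esym/(to_X_rho_eq hp).
- exact: cis_neq0.
- by rewrite cplx_eq0.
by exists (radius u) => //; rewrite radius_gt0.
Qed.

Lemma polar_point u : exists t, cplx u = (radius u)%:C * cis t.
Proof. by rewrite -cmod_cplx; exact: polar. Qed.

Definition polar_map (l : R * R) : R * R := (l.1 * cos l.2, l.1 * sin l.2).

Lemma cplx_polar_map l : cplx (polar_map l) = l.1%:C * cis l.2.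
Proof. by rewrite /cplx /polar_map /cis /=; simpc. Qed.

Lemma radius_polar_map l : 0 < l.1 -> radius (polar_map l) = l.1.
Proof.
by move=> l0; rewrite -cmod_cplx cplx_polar_map cmodM cmod_cis cmodC mulr1 gtr0_norm.
Qed.

Lemma polar_map_neq0 l : 0 < l.1 -> polar_map l != 0.
Proof. by move=> l0; rewrite -radius_gt0 radius_polar_map. Qed.

(** The two functions are each other's derivatives up to sign, hence the
    simultaneous induction. *)
Lemma smooth_cos_sin n :
  class_C n setT (fun l : R * R => cos l.2 : R) /\
  class_C n setT (fun l : R * R => sin l.2 : R).
Proof.
have oT : open [set: R * R] by exact: openT.
elim: n => [|n [Ccos Csin]].
  split=> l _; apply: continuous_comp; try exact: cvg_snd.
    exact: continuous_cos.
  exact: continuous_sin.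
split.
  apply: (@class_C_diff _ _ _ _ _ _ (fun l v => (-1 * sin l.2) * v.2)) => //.
    move=> l _; have D := is_diff_derive (is_diff_snd l) (is_derive_cos _).
    by apply: (is_diff_eq D); apply/funext => v; rewrite mulN1r.
  move=> v; apply: class_CM => //; last exact: smooth_cst.
  by apply: class_CM => //; exact: smooth_cst.
apply: (@class_C_diff _ _ _ _ _ _ (fun l v => cos l.2 * v.2)) => //.
  by move=> l _; exact: (is_diff_derive (is_diff_snd l) (is_derive_sin _)).
by move=> v; apply: class_CM => //; exact: smooth_cst.
Qed.

Lemma smooth_polar_map : smooth_on setT polar_map.
Proof.
have oT : open [set: R * R] by exact: openT.
move=> n; have [Ccos Csin] := smooth_cos_sin n.
by apply: class_C_pair => //; apply: class_CM => //; exact: smooth_fst.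
Qed.

Lemma near_halfplane u t : halfplane t u -> \forall w \near u, halfplane t w.
Proof. by move=> h; exact: (open_nbhs_nbhs (conj (@open_halfplane R t) h)). Qed.

Lemma smooth_near_radius u : u != 0 -> smooth_near u (@radius R).
Proof.
move=> u0; exists [set u | u != 0]; split => //; first exact: open_neq0.
exact: smooth_radius.
Qed.

Lemma smooth_near_local_arg u t : halfplane t u -> smooth_near u (local_arg t).
Proof.
move=> h; exists (halfplane t); split => //; first exact: open_halfplane.
exact: smooth_local_arg.
Qed.

Lemma decomposition_near u t : halfplane t u ->
  \forall w \near u, decomposition hp (cE w) = (cC (radius w), cX (local_arg t w)).
Proof.
move=> /near_halfplane; apply: filterS => w h.
by apply: decomposition_coords; [exact: halfplane_neq0 h|exact: polar_local_arg].
Qed.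

Lemma smooth_decomposition : smooth_map cE (prod_coords cC cX) (decomposition hp).
Proof.
move=> u u0; have [t ut] := polar_point u; have [h _] := halfplane_polar u0 ut.
exists (fun w => (radius w, local_arg t w)); split.
- have nz := @open_neq0 R; have oh := @open_halfplane R t.
  exists (halfplane t); split => // n.
  apply: class_C_pair => //; last exact: smooth_local_arg.
  apply: class_C_subset (@smooth_radius R n) => w; exact: halfplane_neq0.
- by split => //; change (0 < radius u); rewrite radius_gt0.
- by apply: filterS (decomposition_near h) => w ->.
Qed.

(** The inverse (s, t) |-> s exp (i t) of the decomposition.  It does not depend
    on the representatives chosen, by [recomposition_coords]. *)
Definition recomposition (xy : Cp R hp * Xtilde R p) : Ecurve R hp :=
  cE (polar_map (xget 1 [set s | 0 < s /\ xy.1 = cC s], xget 0 [set t | xy.2 = cX t])).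

Lemma recomposition_coords s t : 0 < s ->
  recomposition (cC s, cX t) = cE (polar_map (s, t)).
Proof.
move=> s0; rewrite /recomposition; set s' := xget _ _; set t' := xget _ _.
have [s'0 s'E] : 0 < s' /\ cC s = cC s'.
  exact: (xgetPex 1 (ex_intro (fun s' => 0 < s' /\ cC s = cC s') s (conj s0 erefl))).
have t'E : cX t = cX t'.
  exact: (xgetPex 0 (ex_intro (fun t' => cX t = cX t') t erefl)).
move: s'E t'E => /(coordsC_eq hp s0 s'0)[n ->] /(coordsX_eq hp)[k ->].
apply/esym/(coordsE_eq hp); [exact: polar_map_neq0|apply: polar_map_neq0|].
  by rewrite /= mulr_gt0// pXz_gt0.
exists n; have := @cis_2pi R k; rewrite /cis => -[ck sk].
rewrite /polar_map/= cosD sinD ck sk !mulr1 !mulr0 subr0 addr0.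
by rewrite -!mulrA.
Qed.

Lemma diffeomorphism_decomposition :
  diffeomorphism cE (prod_coords cC cX) (decomposition hp).
Proof.
have eE := @coordsE_etale R p hp; have [oE sE ccE opE _] := eE.
have eC := @coordsC_etale R p hp; have [oC sC ccC opC _] := eC.
have eX := @coordsX_etale R p hp; have [oX sX ccX opX _] := eX.
have cP := prod_coords_continuous eC eX.
have Ksm : smooth_map (prod_coords cC cX) cE recomposition.
  move=> [s t] [/= s0 _]; exists polar_map; split.
  - by exists setT; split; [exact: openT| |exact: smooth_polar_map].
  - exact: polar_map_neq0.
  - have : \forall w \near (s, t), 0 < w.1.
      have : {for (s, t), continuous (@fst R R)} by exact: cvg_fst.
      by move=> /(_ _ (open_nbhs_nbhs (conj (@open_gt R 0) s0))).
    by apply: filterS => -[s1 t1] s10; exact: esym (recomposition_coords t1 s10).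
split.
- exact: (smooth_map_continuous sE opE oE cP smooth_decomposition).
- exact: smooth_decomposition.
exists recomposition; split => //.
- move=> e; have [u u0 ->] := coordsE_surj e; have [t ut] := polar_point u.
  rewrite (decomposition_coords u0 ut) recomposition_coords ?radius_gt0//.
  by congr (cE _); apply: (can_inj (@cplxK R)); rewrite cplx_polar_map -ut.
- move=> [x y]; have [s s0 ->] := coordsC_surj x; have [t ->] := coordsX_surj hp y.
  rewrite recomposition_coords//.
  rewrite (@decomposition_coords _ t) ?radius_polar_map//.
    exact: polar_map_neq0.
  by rewrite cplx_polar_map.
- apply: (smooth_map_continuous _ _ _ ccE Ksm).
  + apply/seteqP; split => // -[x y] _.
    have [s s0 ->] := coordsC_surj x; have [t ->] := coordsX_surj hp y.
    by exists (s, t).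
  + move=> U oU Uc; rewrite openE => _ [[s t] Ust <-].
    have : nbhs (s, t) U by exact: (open_nbhs_nbhs (conj oU Ust)).
    move=> [[A B] [/= As Bt] AB].
    move: As; rewrite nbhsE => -[A' [oA' A's] A'A].
    move: Bt; rewrite nbhsE => -[B' [oB' B't] B'B].
    have s0 : 0 < s := (Uc _ Ust).1.
    have oCA : open (cC @` (A' `&` [set s | 0 < s])).
      by apply: opC; [apply: openI => //; exact: open_gt|move=> ? []].
    have nCA : open_nbhs (cC s) (cC @` (A' `&` [set s | 0 < s])).
      by split => //; exists s.
    have oXB : open (cX @` B') by exact: opX.
    have nXB : open_nbhs (cX t) (cX @` B') by split => //; exists t.
    exists (cC @` (A' `&` [set s | 0 < s]), cX @` B').
      by split; [exact: (open_nbhs_nbhs nCA)|exact: (open_nbhs_nbhs nXB)].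
    move=> [_ _] [/= [s' [A's' _] <-] [t' B't' <-]]; exists (s', t') => //.
    by apply: AB; split; [exact: A'A|exact: B'B].
  + rewrite (_ : cdom _ = @fst R R @^-1` [set s : R | 0 < s]).
      apply: open_comp; last exact: open_gt.
      by move=> ? _; exact: cvg_fst.
    by apply/seteqP; split=> -[? ?] //= [].
Qed.

End smooth_structures.

(** * Differential forms *)

Section forms.
Context {R : realType} (p : nat) (hp : prime p).
Implicit Types (s t : R) (u v : R * R).
Local Notation cE := (coordsE R hp).
Local Notation cC := (coordsC R hp).
Local Notation cX := (coordsX R p).

Lemma smooth_map_id (V : normedModType R) (X : Type) (c : coords V X) :
  smooth_map c c id.
Proof.
move=> u cu; exists id; split => //; first exact: smooth_near_id.
exact: nearW.
Qed.

Lemma local_expr_id (V : normedModType R) (X : Type) (c : coords V X) (u : V)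
    (phi : V -> V) :
  open (cdom c) -> cdom c u -> local_expr c c id u phi -> transition c u phi.
Proof.
move=> oc cu [sphi dphi E]; split => //.
have [U [oU Uu sU]] := sphi.
by apply: filterS (open_nbhs_nbhs (conj oU Uu)) => w Uw; exact: (sU 0%N).
Qed.

(** The changes of coordinates are the multiplications by powers of p, so
    invariance under these is all that is required. *)
Lemma covector_fieldE (T : Type) (alpha : R * R -> R * R -> T) :
  (forall (n : int) u v, u != 0 ->
    alpha (p%:R ^ n *: u) (p%:R ^ n *: v) = alpha u v) ->
  covector_field cE alpha.
Proof.
move=> inv; split; first exact: smooth_map_id.
move=> u u0 phi L v.
have [n nE] := transitionE (local_expr_id (c := cE) (@open_neq0 R) u0 L).
have [_ ->] := near_is_diff nE (is_diff_scaler _ u).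
by rewrite (nbhs_singleton nE) inv.
Qed.

Lemma one_form_dlog : one_form cC dlog_lambda.
Proof.
split.
- split; first exact: smooth_map_id.
  move=> s s0 phi L v.
  have [n nE] := transitionC (local_expr_id (c := cC) (@open_gt R 0) s0 L).
  have [_ ->] := near_is_diff nE (@is_diff_scaler R R^o _ s).
  have pn := @pXz_gt0 R p hp n.
  rewrite (nbhs_singleton nE) /dlog_lambda.
  rewrite -![_ *: _]/(_ * _); field; rewrite !gt_eqF//.
- by move=> u _ a x y; rewrite /dlog_lambda mulrDl -[_ *: (_ / _)]/(_ * _) mulrA.
- move=> v n; apply: class_CM; [exact: open_gt|exact: smooth_cst|].
  apply: class_CV; first exact: open_gt.
    by move=> u /= u0; rewrite gt_eqF.
  by apply: smooth_linear; [exact: open_gt|by []|move=> y; exact: cvg_id].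
Qed.

Lemma one_form_dtheta : one_form cX dtheta.
Proof.
split.
- split; first exact: smooth_map_id.
  move=> s _ phi L v.
  have [k kE] := transitionX hp (local_expr_id (c := cX) openT I L).
  by have [_ ->] := near_is_diff kE (is_diff_translate _ _).
- by [].
- move=> v; exact: smooth_cst.
Qed.

(** The logarithmic differential d|z| / |z| in the coordinate z = x + i y. *)
Definition dlog_radius u v : R := (u.1 * v.1 + u.2 * v.2) * (sqnorm u)^-1.
(** The differential of the argument, in the same coordinate. *)
Definition darg u v : R := (u.1 * v.2 + (-1 * u.2) * v.1) * (sqnorm u)^-1.

(** Any local expression is p^n |z| for some n, and the factor p^n cancels in
    the logarithmic differential. *)
Lemma pullback_dlog :
  is_pullback cE cC (fst \o decomposition hp) dlog_lambda dlog_radius.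
Proof.
split.
  move=> u u0; have [t ut] := polar_point u; have [h _] := halfplane_polar u0 ut.
  exists (@radius R); split; first exact: smooth_near_radius.
    by change (0 < radius u); rewrite radius_gt0.
  by apply: filterS (decomposition_near hp h) => w; rewrite /comp => ->.
move=> u u0 phi [sphi phi0 E] v.
have [t ut] := polar_point u; have [h _] := halfplane_polar u0 ut.
have r0 : 0 < radius u by rewrite radius_gt0.
have E' : \forall w \near u, cC (phi w) = cC (radius w).
  by apply: filterS2 E (decomposition_near hp h) => w ->; rewrite /comp => ->.
have [n nE] := coordsC_rigid (smooth_near_continuous sphi)
  (continuous_radius u0) phi0 r0 E'.
have pn := @pXz_gt0 R p hp n.
have D := is_diffZ (p%:R ^ n) (is_diff_radius u0).
have [_ ->] := near_is_diff nE D.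
rewrite (nbhs_singleton nE) /dlog_lambda /dlog_radius -sqr_radius.
rewrite !fctE -![_ *: _]/(_ * _); field; rewrite !gt_eqF//.
Qed.

(** Any local expression is a branch of the argument plus a multiple of 2 pi. *)
Lemma pullback_dtheta :
  is_pullback cE cX (snd \o decomposition hp) dtheta darg.
Proof.
split.
  move=> u u0; have [t ut] := polar_point u; have [h _] := halfplane_polar u0 ut.
  exists (local_arg t); split => //; first exact: smooth_near_local_arg.
  by apply: filterS (decomposition_near hp h) => w; rewrite /comp => ->.
move=> u u0 phi [sphi _ E] v.
have [t ut] := polar_point u; have [h _] := halfplane_polar u0 ut.
have E' : \forall w \near u, cX (phi w) = cX (local_arg t w).
  by apply: filterS2 E (decomposition_near hp h) => w ->; rewrite /comp => ->.
have [k kE] := coordsX_rigid hp (smooth_near_continuous sphi)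
  (smooth_near_continuous (smooth_near_local_arg h)) E'.
have D := is_diffD (is_diff_local_arg h) (is_diff_cst (2 * pi * k%:~R : R) u).
have [_ ->] := near_is_diff kE D.
by rewrite !fctE addr0.
Qed.

Lemma omegaE u v : u != 0 ->
  omega u v = (dlog_radius u v)%:C + 'i * (darg u v)%:C.
Proof.
move=> u0; have := u0; rewrite -sqnorm_gt0 => s0.
have c0 : cplx u != 0 by rewrite cplx_eq0.
apply: (mulIf c0); rewrite /omega divfK// -complexiE.
rewrite /dlog_radius /darg /cplx; simpc.
by apply/eqP; rewrite eq_complex/=; apply/andP; split; apply/eqP;
  rewrite /sqnorm in s0 *; field; rewrite gt_eqF.
Qed.

Lemma complex_derivable_inv (s z : R[i]) : z != 0 ->
  @derivable R[i] (R[i])^o (R[i])^o (fun w => s * w^-1) z 1.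
Proof.
move=> z0; apply: (@derivableM R[i] (R[i])^o (cst s) (fun w => w^-1)).
  exact: derivable_cst.
by apply: derivableV => //; exact: derivable_id.
Qed.

Lemma cplxZ (a : R) u : cplx (a *: u) = a%:C * cplx u.
Proof. by case: u => x y; rewrite /cplx/=; simpc. Qed.

Lemma holomorphic_scaled_omega (s : R[i]) eta :
  (forall u v, u != 0 -> eta u v = s * omega u v) -> holomorphic_form cE eta.
Proof.
move=> E; split.
  apply: covector_fieldE => n u v u0.
  have pn : p%:R ^ n != 0 :> R by rewrite gt_eqF ?(pXz_gt0 hp).
  have c0 : cplx u != 0 by rewrite cplx_eq0.
  have pc : (p%:R ^ n)%:C != 0 :> R[i].
    by rewrite -(rmorph0 (real_complex R)) (inj_eq (@complexI _)).
  by rewrite !E ?scaler_eq0 ?negb_or ?pn// /omega !cplxZ -mulf_div divff// mul1r.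
exists (fun z => s * z^-1).
  by move=> _ [u u0 <-]; apply: complex_derivable_inv; rewrite cplx_eq0.
by move=> u u0 v; rewrite E// /omega mulrA mulrAC.
Qed.

Lemma holomorphic_omega : holomorphic_form cE omega.
Proof. by apply: (@holomorphic_scaled_omega 1) => u v _; rewrite mul1r. Qed.

Lemma nowhere_vanishing_omega : nowhere_vanishing cE omega.
Proof.
move=> u u0; exists u; rewrite /omega divff ?oner_neq0// cplx_eq0.
exact: u0.
Qed.

(** At the point 1, the form takes the value s on the vector 1 and t on the
    vector i; it is C-linear when it is holomorphic. *)
Lemma holomorphic_combination (s t : R[i]) :
  holomorphic_form cE
    (fun u v => s * (dlog_radius u v)%:C + t * (darg u v)%:C) <-> t = 'i * s.
Proof.
split=> [[_ [h _ hE]]|->].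
  have u0 : ((1, 0) : R * R) != 0.
    by rewrite -cplx_eq0 eq_complex/= oner_eq0.
  have := hE _ u0 (1, 0); have := hE _ u0 (0, 1).
  rewrite /dlog_radius /darg /sqnorm /= !(mulr0, mul0r, mulr1, mul1r, addr0, add0r).
  rewrite invr1 !rmorph1 !mulr1.
  rewrite /cplx/= => -> ->.
  by rewrite -complexiE mulrC.
apply: (@holomorphic_scaled_omega s) => u v u0.
by rewrite omegaE// mulrDr mulrCA mulrA.
Qed.

(** Either the real or the imaginary part of g v, for v = 1 and v = i,
    determines the complex number g. *)
Lemma holomorphic_unique eta : holomorphic_form cE eta ->
  (forall u v, u != 0 -> complex.Re (eta u v) = dlog_radius u v) \/
  (forall u v, u != 0 -> complex.Im (eta u v) = darg u v) ->
  forall u v, u != 0 -> eta u v = omega u v.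
Proof.
move=> [_ [h _ hE]] H u v u0; rewrite hE// /omega mulrC; congr (_ * _).
have c0 : cplx u != 0 by rewrite cplx_eq0.
have e1 := hE _ u0 (1, 0); have ei := hE _ u0 (0, 1).
have o1 := omegaE (1, 0) u0; have oi := omegaE (0, 1) u0.
move: e1 ei o1 oi; rewrite /omega (_ : cplx (1, 0) = 1)// (_ : cplx (0, 1) = 'i%C)//.
rewrite mulr1 div1r -complexiE; set q := (cplx u)^-1; set g := h _.
case: q g => [qx qy] [gx gy] e1 ei.
simpc => -[q1 q2] -[q3 q4]; rewrite /= in e1 ei.
case: H => H; have := H _ (1, 0) u0; have := H _ (0, 1) u0; rewrite e1 ei/=.
  by rewrite -q3 -q1 mulr0 mulr1 sub0r => /oppr_inj -> ->.
by rewrite -q4 -q2 mulr0 mulr1 addr0 => -> ->.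
Qed.

End forms.

(** * Lengths *)

Section lengths.
Context {R : realType} (p : nat) (hp : prime p).
Implicit Types (s t : R) (u v : R * R).
Local Notation cC := (coordsC R hp).
Local Notation cX := (coordsX R p).

Lemma ln_pXz (n : int) : ln (p%:R ^ n : R) = ln p%:R * n%:~R.
Proof.
have p0 : 0 < p%:R :> R by rewrite (lt_trans _ (@p_gt1 R p hp)).
have lnX (m : nat) : ln (p%:R ^+ m : R) = ln p%:R * m%:R.
  by rewrite lnXn// mulr_natr.
case: n => n; first exact: lnX.
by rewrite NegzE -exprnN lnV ?posrE ?exprn_gt0// lnX mulrNz mulrN.
Qed.

(** The exponent is minus the integral part of ln s / ln p. *)
Lemma pZ_fundamental s : 0 < s ->
  exists n : int, 1 <= s * p%:R ^ n < p%:R.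
Proof.
move=> s0; have p1 := @p_gt1 R p hp; have p0 : 0 < p%:R :> R by apply: lt_trans p1.
have l0 : 0 < ln p%:R :> R by rewrite ln_gt0.
pose k := Num.floor (ln s / ln p%:R); exists (- k).
have q0 := @pXz_gt0 R p hp (- k).
have sq : 0 < s * p%:R ^ (- k) by rewrite mulr_gt0.
rewrite -(@ler_ln R) ?posrE// -(@ltr_ln R) ?posrE// ln1 lnM ?posrE// ln_pXz.
rewrite mulrNz mulrN subr_ge0 mulrC -ler_pdivlMr// Num.Theory.floor_le/=.
rewrite ltrBlDr -{1}[ln p%:R]mul1r -mulrDl -ltr_pdivrMr//.
by rewrite addrC -[1]/(1%:~R) -intrD floorD1_gt.
Qed.

Lemma simple_loopC s : 0 < s -> simple_loop cC s (p%:R * s).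
Proof.
move=> s0; have p1 := @p_gt1 R p hp; have p0 : 0 < p%:R :> R by apply: lt_trans p1.
split.
- by rewrite ltr_pMl.
- by move=> t /=; rewrite in_itv/= => /andP[st _]; exact: lt_le_trans st.
- split=> //.
  + move=> x y /set_mem; rewrite /= in_itv/= => /andP[sx xs] /set_mem.
    rewrite /= in_itv/= => /andP[sy ys].
    have x0 : 0 < x by apply: lt_le_trans sx.
    have y0 : 0 < y by apply: lt_le_trans sy.
    move=> /(coordsC_eq hp x0 y0)[n nE].
    have n1 : p%:R ^ n < p%:R ^ 1 :> R.
      rewrite expr1z -(ltr_pM2r x0) -nE (lt_le_trans ys)// ler_pM2l//.
    have n2 : p%:R ^ (-1) < p%:R ^ n :> R.
      rewrite -(ltr_pM2r x0) -nE exprN1 -(ltr_pM2l p0) mulrA divff ?gt_eqF// mul1r.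
      by rewrite (lt_le_trans xs)// ler_pM2l.
    rewrite !(ltr_eXz2l p1) in n1 n2.
    have n0 : n = 0 by lia.
    by rewrite nE n0 expr0z mul1r.
  + move=> x _; have [t t0 ->] := coordsC_surj x.
    have [n /andP[n1 n2]] := pZ_fundamental (divr_gt0 t0 s0).
    have q0 := @pXz_gt0 R p hp n.
    exists (t * p%:R ^ n) => /=.
      have e : t * p%:R ^ n = t / s * p%:R ^ n * s by field; rewrite gt_eqF.
      by rewrite in_itv/= e ltr_pM2r// -[X in X <= _]mul1r ler_pM2r// n1.
    apply/esym/(coordsC_eq hp) => //; first exact: mulr_gt0.
    by exists n; rewrite mulrC.
- apply/esym/(coordsC_eq hp) => //; first exact: mulr_gt0.
  by exists 1; rewrite expr1z.
Qed.

(** The end is p^n s with n > 0; if n > 1, the loop meets p s, which has the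
    same image as s, before its end. *)
Lemma simple_loopC_eq s t : simple_loop cC s t -> 0 < s /\ t = p%:R * s.
Proof.
move=> [st sub [_ inj _] E]; have p1 := @p_gt1 R p hp.
have p0 : 0 < p%:R :> R by apply: lt_trans p1.
have s0 : 0 < s by apply: sub; rewrite /= in_itv/= lexx ltW.
split => //; have t0 : 0 < t by exact: lt_trans st.
have [n nE] := (coordsC_eq hp s0 t0).1 (esym E).
have n0 : p%:R ^ 0 < p%:R ^ n :> R.
  by rewrite expr0z -(ltr_pM2r s0) mul1r -nE.
rewrite (ltr_eXz2l p1) in n0.
have [n1|n1] := leP n 1.
  by rewrite nE; have -> : n = 1 by lia.
have pst : p%:R * s < t.
  by rewrite nE ltr_pM2r// -[X in X < _]expr1z (ltr_eXz2l p1).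
have sps : s < p%:R * s by rewrite ltr_pMl.
have : s = p%:R * s.
  apply: inj; rewrite ?inE/= ?in_itv/= ?lexx ?st ?pst ?(ltW sps)//.
  by have [_ _ _ e] := simple_loopC s0; exact: esym e.
by move=> e; move: sps; rewrite -e ltxx.
Qed.

Lemma total_length_dlog : total_length cC dlog_lambda (ln p%:R).
Proof.
split; first by exists 1, (p%:R * 1); apply: simple_loopC.
have p1 := @p_gt1 R p hp; have p0 : 0 < p%:R :> R by apply: lt_trans p1.
move=> a b /simple_loopC_eq[a0 ->].
have ab : a < p%:R * a by rewrite ltr_pMl.
have b0 : 0 < p%:R * a by rewrite mulr_gt0.
have D (x : R) : 0 < x -> is_derive x 1 (@ln R) x^-1.
  by move=> x0; exact: is_derive1_ln.
rewrite /Rintegral (@continuous_FTC2 _ (fun t => dlog_lambda t 1) (@ln R))//.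
- by rewrite -EFinB /= lnM ?posrE// addrK.
- apply: continuous_in_subspaceT => x /set_mem/=; rewrite in_itv/= => /andP[ax _].
  have x0 : 0 < x by apply: lt_le_trans ax.
  rewrite /dlog_lambda; under eq_fun do rewrite div1r.
  by apply: inv_continuous; rewrite gt_eqF.
- split.
  + move=> x; rewrite in_itv/= => /andP[ax _]; have [//] := D x (lt_trans a0 ax).
  + by apply: cvg_at_right_filter; exact: continuous_ln.
  + by apply: cvg_at_left_filter; exact: continuous_ln.
- move=> x; rewrite in_itv/= => /andP[ax _]; rewrite derive1E.
  by have [_ ->] := D x (lt_trans a0 ax); rewrite /dlog_lambda div1r.
Qed.

Lemma simple_loopX s : simple_loop cX s (s + 2 * pi).
Proof.
have tp : 0 < 2 * pi :> R by rewrite mulr_gt0// pi_gt0.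
split.
- by rewrite ltrDl.
- by [].
- split=> //.
  + move=> x y /set_mem; rewrite /= in_itv/= => /andP[sx xs] /set_mem.
    rewrite /= in_itv/= => /andP[sy ys] /(coordsX_eq hp)[k kE].
    have : `|2 * pi * k%:~R : R| < 2 * pi.
      by rewrite (_ : _ * _ = y - x); [rewrite ltr_norml; lra|rewrite kE; ring].
    rewrite normrM (gtr0_norm tp) gtr_pMr// -intr_norm -[1]/(1%:~R) ltr_int => k1.
    have k0 : k = 0 by lia.
    by rewrite kE k0 mulr0 addr0.
  + move=> x _; have [t ->] := coordsX_surj hp x.
    pose k := Num.floor ((t - s) / (2 * pi)).
    have k1 : 2 * pi * k%:~R <= t - s.
      by rewrite mulrC -ler_pdivlMr// Num.Theory.floor_le.
    have k2 : t - s < 2 * pi * k%:~R + 2 * pi.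
      rewrite -[X in _ < _ + X]mulr1 -mulrDr mulrC -ltr_pdivrMr//.
      by rewrite -[1]/(1%:~R) -intrD floorD1_gt.
    exists (t - 2 * pi * k%:~R).
      by rewrite /= in_itv/=; lra.
    by apply/(coordsX_eq hp); exists k; rewrite subrK.
- by apply/esym/(coordsX_eq hp); exists 1; rewrite mulr1.
Qed.

Lemma simple_loopX_eq s t : simple_loop cX s t -> t = s + 2 * pi.
Proof.
have tp : 0 < 2 * pi :> R by rewrite mulr_gt0// pi_gt0.
move=> [st _ [_ inj _] /esym/(coordsX_eq hp)[k kE]].
have k0 : 0 < k.
  by move: st; rewrite kE ltrDl pmulr_rgt0// ltr0z.
have [k1|k1] := leP k 1.
  by rewrite kE (_ : k = 1) ?mulr1//; lia.
have pst : s + 2 * pi < t.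
  by rewrite kE ltrD2l ltr_pMr// -[1]/(1%:~R) ltr_int.
have sps : s < s + 2 * pi by rewrite ltrDl.
have : s = s + 2 * pi.
  apply: inj; rewrite ?inE/= ?in_itv/= ?lexx ?st ?pst ?(ltW sps)//.
  by have [_ _ _ e] := simple_loopX s; exact: esym e.
by move=> e; move: sps; rewrite -e ltxx.
Qed.

Lemma total_length_dtheta : total_length cX dtheta (2 * pi).
Proof.
have tp : 0 < 2 * pi :> R by rewrite mulr_gt0// pi_gt0.
split; first by exists 0, (0 + 2 * pi); exact: simple_loopX.
move=> a b /simple_loopX_eq ->.
have mE : lebesgue_measure (`[a, a + 2 * pi]%classic : set R) = (2 * pi)%:E.
  by rewrite lebesgue_measure_itv/= lte_fin ltrDl tp -EFinB addrAC subrr add0r.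
rewrite /dtheta Rintegral_cst// mul1r.
exact: (congr1 fine mE).
Qed.

End lengths.

(** * Independence of the prime *)

Section independence.
Context {R : realType}.
Implicit Types (p q : nat).

(** The canonical identification of the double covers for two primes: it keeps
    the angle. *)
Definition Xtilde_transfer p q (x : Xtilde R p) : Xtilde R q :=
  coordsX R q (xget 0 [set t | x = coordsX R p t]).

Lemma Xtilde_transfer_coords p q (hp : prime p) (hq : prime q) (t : R) :
  Xtilde_transfer q (coordsX R p t) = coordsX R q t.
Proof.
rewrite /Xtilde_transfer; set t' := xget _ _.
have : coordsX R p t = coordsX R p t'.
  exact: (xgetPex 0 (ex_intro (fun t' => coordsX R p t = coordsX R p t') t erefl)).
by move=> /(coordsX_eq hp) E; apply/esym/(coordsX_eq hq).
Qed.

Lemma Xtilde_transfer_rho p q (hp : prime p) (hq : prime q) (z : R[i]) : z != 0 ->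
  Xtilde_transfer q (to_X (rho p z)) = to_X (rho q z).
Proof.
move=> z0; have [t tE] := polar z.
have E p' (hp' : prime p') : to_X (rho p' z) = coordsX R p' t.
  rewrite /= cexp_imag; apply/esym/(to_X_rho_eq hp') => //; first exact: cis_neq0.
  by exists (cmod z) => //; rewrite cmod_gt0.
by rewrite !E// Xtilde_transfer_coords.
Qed.

Lemma smooth_transfer p q (hp : prime p) (hq : prime q) :
  smooth_map (coordsX R p) (coordsX R q) (@Xtilde_transfer p q).
Proof.
move=> t _; exists id; split => //; first exact: smooth_near_id.
near=> w; exact: esym (Xtilde_transfer_coords hp hq w).
Unshelve. all: by end_near.
Qed.

Lemma continuous_transfer p q (hp : prime p) (hq : prime q) :
  continuous (@Xtilde_transfer p q).
Proof.
have eX := @coordsX_etale R p hp; have [oX sX ccX opX _] := eX.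
have eY := @coordsX_etale R q hq; have [oY sY ccY opY _] := eY.
exact: (smooth_map_continuous sX opX oX ccY (smooth_transfer hp hq)).
Qed.

Lemma transfer_diffeomorphism p q (hp : prime p) (hq : prime q) :
  diffeomorphism (coordsX R p) (coordsX R q) (@Xtilde_transfer p q).
Proof.
have K p1 p2 (h1 : prime p1) (h2 : prime p2) :
    cancel (@Xtilde_transfer p1 p2) (@Xtilde_transfer p2 p1).
  move=> x; have [t ->] := coordsX_surj h1 x.
  by rewrite !Xtilde_transfer_coords.
split; [exact: continuous_transfer|exact: smooth_transfer|].
exists (@Xtilde_transfer q p); split.
- exact: K.
- exact: K.
- exact: continuous_transfer.
- exact: smooth_transfer.
Qed.

Lemma transfer_pullback p q (hp : prime p) (hq : prime q) :
  is_pullback (coordsX R p) (coordsX R q) (@Xtilde_transfer p q) dtheta dtheta.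
Proof.
split; first exact: smooth_transfer.
move=> t _ phi [sphi _ E] v.
have E' : \forall w \near t, coordsX R q (phi w) = coordsX R q (id w).
  by apply: filterS E => w ->; rewrite Xtilde_transfer_coords.
have cid : {for t, continuous (@id R)} by exact: cvg_id.
have [k kE] := coordsX_rigid hq (smooth_near_continuous sphi) cid E'.
by have [_ ->] := near_is_diff kE (is_diff_translate _ _).
Qed.

End independence.

Unset Implicit Arguments.

Theorem theorem4 (R : realType) (p : nat) (hp : prime p) :
  (* M_p^oo = C^x, E_p = C^x / p^Z *)
  [/\ set_bij [set z : R[i] | z != 0] setT (@rho R p),
      (forall z : R[i], z != 0 -> \val (rho p z : character R p) = rho_fun p z),
      (forall z z' : R[i], z != 0 -> z' != 0 ->
        to_E hp (rho p z) = to_E hp (rho p z') <->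
        exists n : int, z' = p%:R ^ n * z) &
      riemann_surface (coordsE R hp)] /\
  (* E_p = C_p x X~_oo *)
  [/\ smooth_manifold (coordsE R hp),
      smooth_manifold (coordsC R hp),
      smooth_manifold (coordsX R p),
      (forall z : R[i], z != 0 ->
        decomposition hp (to_E hp (rho p z)) =
        (to_C hp (cmod z), to_X (rho p z))) &
      diffeomorphism (coordsE R hp) (prod_coords (coordsC R hp) (coordsX R p))
        (decomposition hp)] /\
  (* the two real 1-forms and their lengths; independence of p *)
  [/\ one_form (coordsC R hp) dlog_lambda,
      total_length (coordsC R hp) dlog_lambda (ln p%:R),
      one_form (coordsX R p) dtheta,
      total_length (coordsX R p) dtheta (2 * pi) &
      forall q : nat, prime q ->
        exists2 f : Xtilde R p -> Xtilde R q,
          diffeomorphism (coordsX R p) (coordsX R q) f /\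
          (forall z : R[i], z != 0 -> f (to_X (rho p z)) = to_X (rho q z)) &
          is_pullback (coordsX R p) (coordsX R q) f dtheta dtheta] /\
  (* the holomorphic 1-form *)
  [/\ holomorphic_form (coordsE R hp) omega,
      nowhere_vanishing (coordsE R hp) omega &
      exists a b : R * R -> R * R -> R,
        [/\ is_pullback (coordsE R hp) (coordsC R hp)
              (fst \o decomposition hp) dlog_lambda a,
            is_pullback (coordsE R hp) (coordsX R p)
              (snd \o decomposition hp) dtheta b,
            (forall u v, u != 0 -> omega u v = (a u v)%:C + 'i * (b u v)%:C),
            (forall s t : R[i],
              holomorphic_form (coordsE R hp)
                (fun u v => s * (a u v)%:C + t * (b u v)%:C) <->
              t = 'i * s) &
            (forall eta, holomorphic_form (coordsE R hp) eta ->
              (forall u v, u != 0 -> complex.Re (eta u v) = a u v) \/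
              (forall u v, u != 0 -> complex.Im (eta u v) = b u v) ->
              forall u v, u != 0 -> eta u v = omega u v)]].
Proof.
split; [|split; [|split]].
- split.
  + exact: rho_bij.
  + exact: val_rho.
  + exact: to_E_rho_eq.
  + exact: riemann_surfaceE.
- split.
  + exact: smooth_manifoldE.
  + exact: smooth_manifoldC.
  + exact: smooth_manifoldX.
  + exact: decomposition_rho.
  + exact: diffeomorphism_decomposition.
- split.
  + exact: one_form_dlog.
  + exact: total_length_dlog.
  + exact: one_form_dtheta.
  + exact: total_length_dtheta.
  + move=> q hq; exists (@Xtilde_transfer R p q); last exact: transfer_pullback.
    split; first exact: transfer_diffeomorphism.
    by move=> z z0; exact: Xtilde_transfer_rho.
- split.
  + exact: holomorphic_omega.
  + exact: nowhere_vanishing_omega.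
  + exists (@dlog_radius R), (@darg R); split.
    * exact: pullback_dlog.
    * exact: pullback_dtheta.
    * exact: omegaE.
    * exact: holomorphic_combination.
    * exact: holomorphic_unique.
Qed.
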